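(* Let $n\in\{1,2,3\}$ and $m\in\mathbb{N}^*=\{1,2,\dots\}$ satisfy $2m>\frac{n+2}{2}$. There exists a constant $C=C(m,n)>0$ such that for all functions $g\in L^2(\mathbb{R}^{n+1})$ with $\|g\|_{L^2(\mathbb{R}^{n+1})}\le 1$ and $f=\nabla g\in W^{2m,m}_2(\mathbb{R}^{n+1})$, we have $$\left(\log^+\big(\|f\|_{W^{2m,m}_2(\mathbb{R}^{n+1})}+\|g\|_{L^\infty(\mathbb{R}^{n+1})}\big)\right)^{1/2}\le C\left(1+\log^+\|f\|_{W^{2m,m}_2(\mathbb{R}^{n+1})}\right).$$ Hence, for this class of functions, the inequality $$\|f\|_{L^\infty(\mathbb{R}^{n+1})}\le C_1\left(1+\|f\|_{BMO^a(\mathbb{R}^{n+1})}\left(\log^+\big(\|f\|_{W^{2m,m}_2(\mathbb{R}^{n+1})}+\|g\|_{L^\infty(\mathbb{R}^{n+1})}\big)\right)^{1/2}\right)$$ with a constant $C_1=C_1(m,n)>0$ implies the inequality $$\|f\|_{L^\infty(\mathbb{R}^{n+1})}\le C_2\left(1+\|f\|_{BMO^a(\mathbb{R}^{n+1})}\left(1+\log^+\|f\|_{W^{2m,m}_2(\mathbb{R}^{n+1})}\right)\right)$$ with a possibly different constant $C_2=C_2(m,n)>0$.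
   Context: Points of $\mathbb{R}^{n+1}$ are written $z=(x,t)$, $x=(x_1,\dots,x_n)\in\mathbb{R}^n$, $t\in\mathbb{R}$. The symbol $\nabla g=(\partial_{x_1}g,\dots,\partial_{x_n}g,\partial_t g)$ is the space-time gradient. $\log^+ x=\max(\log x,0)$. For a vector-valued function $f=(f_1,\dots,f_{n+1})$ with components in a Banach space $X$, one writes $f\in X$ and $\|f\|_X=\max_{1\le i\le n+1}\|f_i\|_X$. Parabolic distance: the anisotropy is $a=(1,\dots,1,2)\in\mathbb{R}^{n+1}$; for $z\ne0$, $|z|_a$ is the unique $\mu>0$ with $\frac{x_1^2}{\mu^2}+\cdots+\frac{x_n^2}{\mu^2}+\frac{t^2}{\mu^4}=1$, and $|0|_a=0$. Parabolic BMO: a function $f\in L^1_{loc}(\mathbb{R}^{n+1})$ (defined up to an additive constant) is in $BMO^a(\mathbb{R}^{n+1})$ if $$\|f\|_{BMO^a(\mathbb{R}^{n+1})}=\sup_{\mathcal{Q}}\inf_{c\in\mathbb{R}}\frac1{|\mathcal{Q}|}\int_{\mathcal{Q}}|f-c|<\infty,$$ the supremum being over all parabolic cubes $\mathcal{Q}=\{z\in\mathbb{R}^{n+1}: |z-z_0|_a<r\}$, $z_0\in\mathbb{R}^{n+1}$, $r>0$. Parabolic Sobolev space: $W^{2m,m}_2(\mathbb{R}^{n+1})$ is the set of $f\in L^2(\mathbb{R}^{n+1})$ with $\partial_t^r\partial_x^s f\in L^2(\mathbb{R}^{n+1})$ for all $r,s\in\mathbb{N}$ with $2r+s\le 2m$,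 where $\partial_x^s$ denotes any derivative of order $s$ with respect to $x$; its norm is $\|f\|_{W^{2m,m}_2}=\sum_{j=0}^{2m}\sum_{2r+s=j}\|\partial_t^r\partial_x^s f\|_{L^2}$. *)

(* Defs.v *)
From HB Require Import structures.
From mathcomp Require Import all_boot all_order all_algebra.
From mathcomp Require Import all_classical all_reals all_analysis.

Set Implicit Arguments.
Unset Strict Implicit.
Unset Printing Implicit Defensive.
Import Order.TTheory GRing.Theory Num.Theory.
Import numFieldNormedType.Exports.
Local Open Scope classical_set_scope.
Local Open Scope ring_scope.

Fact rV_display : measure_display.
Proof. exact: default_measure_display. Qed.

(* The sigma-algebra on 'rV[R]_k is the product (hence Borel) one, generated by
   the coordinate functions. *)
Section measurable_rV.
Context {R : realType}.
Variable k : nat.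

Let coor : 'I_k -> 'rV[R]_k -> R := fun i v => v ord0 i.

Let rV_set0 : g_sigma_preimage coor set0.
Proof. exact: sigma_algebra0. Qed.

Let rV_setC A : g_sigma_preimage coor A -> g_sigma_preimage coor (~` A).
Proof. exact: sigma_algebraC. Qed.

Let rV_bigcup (F : _^nat) : (forall i, g_sigma_preimage coor (F i)) ->
  g_sigma_preimage coor (\bigcup_i (F i)).
Proof. exact: sigma_algebra_bigcup. Qed.

HB.instance Definition _ := @isMeasurable.Build rV_display
  'rV[R]_k (g_sigma_preimage coor) rV_set0 rV_setC rV_bigcup.

End measurable_rV.

Section lebesgue_rV.
Context {R : realType}.

Definition rV_cons k (p : measurableTypeR R * 'rV[R]_k) : 'rV[R]_k.+1 :=
  \row_i oapp (p.2 ord0) p.1 (unlift ord0 i).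

Lemma measurable_coor k (i : 'I_k) :
  measurable_fun [set: 'rV[R]_k] (fun v => v ord0 i : measurableTypeR R).
Proof.
move=> _ Y mY; rewrite setTI; apply: sub_sigma_algebra => /=.
rewrite -bigcup_seq/=; exists i => /=; first by rewrite mem_index_enum.
by exists Y => //; rewrite setTI.
Qed.

Lemma measurable_rV d (T : measurableType d) k (f : T -> 'rV[R]_k) :
  (forall i, measurable_fun setT (fun x => f x ord0 i : measurableTypeR R)) ->
  measurable_fun setT f.
Proof.
move=> mf; apply: measurability; first by [].
move=> _ [A + <-]; rewrite -bigcup_seq => -[i /= _ [Y mY <-]].
by rewrite !setTI -comp_preimage -[X in measurable X]setTI; exact: mf.
Qed.

Lemma measurable_rV_cons k : measurable_fun [set: _] (@rV_cons k).
Proof.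
apply: measurable_rV => i; under eq_fun do rewrite mxE.
case: unliftP => [j _|_] /=; last exact: measurable_fst.
exact: measurableT_comp (measurable_coor j) measurable_snd.
Qed.

Section step.
Variables (k : nat) (mu : {sigma_finite_measure set 'rV[R]_k -> \bar R}).

Definition lebesgue_rV_step : set 'rV[R]_k.+1 -> \bar R :=
  pushforward (@lebesgue_measure R \x mu)%E (@rV_cons k).

HB.instance Definition _ := Measure.copy lebesgue_rV_step
  (measure_function_pushforward__canonical__measure_function_Measure
    (@lebesgue_measure R \x mu)%E (@measurable_rV_cons k)).

Let sigma_finite_step : sigma_finite setT lebesgue_rV_step.
Proof.
have /sigma_finiteP[F [TF ndF Foo]] := sigma_finiteT (@lebesgue_measure R).
have /sigma_finiteP[G [TG ndG Goo]] := sigma_finiteT mu.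
pose u (v : 'rV[R]_k.+1) : measurableTypeR R * 'rV[R]_k :=
  (v ord0 ord0, \row_j v ord0 (lift ord0 j)).
have mu_ : measurable_fun setT u.
  apply: measurable_fun_pair; first exact: measurable_coor.
  apply: measurable_rV => i; under eq_fun do rewrite mxE.
  exact: measurable_coor.
have uK : cancel (@rV_cons k) u.
  move=> [x v]; rewrite /u /rV_cons !mxE unlift_none; congr (_, _).
  by apply/rowP => j; rewrite !mxE liftK.
exists (fun i => u @^-1` (F i `*` G i)).
  rewrite -preimage_bigcup (_ : \bigcup_i _ = setT) ?preimage_setT//.
  rewrite -subTset => -[x y] _.
  have [n _ Fnx] : (\bigcup_i F i) x by rewrite -TF.
  have [p _ Gpy] : (\bigcup_i G i) y by rewrite -TG.
  exists (maxn n p) => //; split => /=.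
  - by move: x Fnx; exact/subsetPset/ndF/leq_maxl.
  - by move: y Gpy; exact/subsetPset/ndG/leq_maxr.
move=> i; have [mF Fi] := Foo i; have [mG Gi] := Goo i; split.
  by rewrite -[X in measurable X]setTI; apply: mu_ => //; exact: measurableX.
rewrite /lebesgue_rV_step /pushforward -comp_preimage.
rewrite (_ : u \o _ = id); last by apply/funext => p /=; rewrite uK.
by rewrite preimage_id product_measure1E// lte_mul_pinfty// ge0_fin_numE.
Qed.

HB.instance Definition _ := Measure_isSigmaFinite.Build _ _ _
  lebesgue_rV_step sigma_finite_step.

End step.

Fixpoint lebesgue_rV k : {sigma_finite_measure set 'rV[R]_k -> \bar R} :=
  match k with
  | 0 => @dirac _ 'rV[R]_0 0 R
  | k'.+1 => lebesgue_rV_step (lebesgue_rV k')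
  end.

End lebesgue_rV.

Section parabolic.
Context {R : realType} {n : nat}.
Implicit Types (f g h phi : 'rV[R]_n.+1 -> R) (z : 'rV[R]_n.+1).
Implicit Types (al : 'I_n.+1 -> nat) (F : 'I_n.+1 -> 'rV[R]_n.+1 -> R).

Local Notation mu := (lebesgue_rV n.+1).

(* Coordinate ord_max is the time t; the n others are x_1, ..., x_n. *)
Definition anisotropy (i : 'I_n.+1) : nat := if i == ord_max then 2 else 1.

Definition parabolic_norm z : R :=
  if z == 0 then 0 else
  xget 0 [set r | 0 < r /\
                  \sum_i z ord0 i ^+ 2 / r ^+ (2 * anisotropy i) = 1].

Definition parabolic_cube (z0 : 'rV[R]_n.+1) (r : R) : set 'rV[R]_n.+1 :=
  [set z | parabolic_norm (z - z0) < r].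

Definition mean_oscillation f (Q : set 'rV[R]_n.+1) : \bar R :=
  ereal_inf [set ((mu Q)^-1 * \int[mu]_(z in Q) `|f z - c|%:E)%E | c in setT].

Definition bmo_norm f : \bar R :=
  ereal_sup [set mean_oscillation f (parabolic_cube p.1 p.2) |
             p in [set p : 'rV[R]_n.+1 * R | 0 < p.2]].

Definition partial (i : 'I_n.+1) phi : 'rV[R]_n.+1 -> R :=
  fun z => 'D_(delta_mx ord0 i) phi z.

Definition multi_partial al phi : 'rV[R]_n.+1 -> R :=
  foldr (fun i psi => iter (al i) (partial i) psi) phi (enum 'I_n.+1).

Definition smooth phi : Prop :=
  forall s : seq 'I_n.+1, forall z, differentiable (foldr partial phi s) z.

Definition test_function phi : Prop :=
  smooth phi /\ compact (closure [set z | phi z != 0]).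

Definition locally_L1 f : Prop :=
  measurable_fun setT f /\
  forall K, compact K -> (\int[mu]_(z in K) `|f z|%:E < +oo)%E.

Definition weak_partial al f h : Prop :=
  [/\ locally_L1 f, locally_L1 h &
      forall phi, test_function phi ->
        \int[mu]_z (f z * multi_partial al phi z) =
        (-1) ^+ (\sum_i al i)%N * \int[mu]_z (h z * phi z)].

(* A representative of the weak derivative, when there is one; all of them are
   equal almost everywhere. *)
Definition weakD al f : 'rV[R]_n.+1 -> R :=
  xget (cst 0) [set h | weak_partial al f h].

Definition weak_gradient g F : Prop :=
  forall i, weak_partial (fun j => (j == i : nat)) g (F i).

Definition parabolic_order al : nat := (\sum_i anisotropy i * al i)%N.

Definition parabolic_sobolev (m : nat) f : Prop :=
  f \in Lfun mu 2%:E /\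
  forall al, (parabolic_order al <= 2 * m)%N ->
    exists2 h, weak_partial al f h & h \in Lfun mu 2%:E.

(* Each exponent of a multi-index of parabolic order at most 2m is at most 2m,
   so 'I_(2 * m).+1 contains all of them. *)
Definition parabolic_sobolev_norm (m : nat) f : \bar R :=
  (\sum_(j < (2 * m).+1)
     \sum_(al : {ffun 'I_n.+1 -> 'I_(2 * m).+1} |
            parabolic_order (fun i => al i) == j)
       'N[mu]_2%:E [EFin \o weakD (fun i => al i) f])%E.

Definition Linfty_norm f : \bar R := ('N[mu]_+oo [EFin \o f])%E.

(* All the norms it is applied to are nonnegative, so the neutral element 0
   does not affect the maximum. *)
Definition max_norm (N : ('rV[R]_n.+1 -> R) -> \bar R) F : \bar R :=
  \big[maxe/0%E]_(i < n.+1) N (F i).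

Definition gradient_class (m : nat) g F : Prop :=
  [/\ g \in Lfun mu 2%:E, ('N[mu]_2%:E [EFin \o g] <= 1)%E,
      weak_gradient g F & forall i, parabolic_sobolev m (F i)].

End parabolic.

Definition logp {R : realType} (x : \bar R) : \bar R := maxe (lne x) 0%E.

(* Main.v *)
(* The first inequality only needs the bound |g|_oo <= M (1 + |f|_W).  Since
   n <= 2m, every mixed derivative d^al g with al in {0,1}^(n+1) is in L^2: for
   al <> 0 it is a derivative d^(al - e_i) f_i of parabolic order at most n.  In
   one variable, a smooth approximation b of the indicator function of an
   interval is p' + q with p and q smooth, supported in a fixed window and of
   size O(int b).  Expanding a product of such functions, one gets a test
   function phi = sum_al d^al(Theta_al) approximating the indicator function of
   a dyadic cube Q, so that |int g phi| <= sum_al |d^al g|_2 |Theta_al|_2 is at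
   most M (1 + |f|_W) |Q|, and in the limit the same bound holds for |int_Q g|.
   As this is valid for all dyadic cubes, |g| <= M (1 + |f|_W) almost
   everywhere. *)
Require Import Defs.
From mathcomp Require Import all_boot all_order all_algebra.
From mathcomp Require Import all_classical all_reals all_analysis.
From mathcomp Require Import measurable_realfun ess_sup_inf.
From mathcomp Require Import zify ring lra.

Set Implicit Arguments.
Unset Strict Implicit.
Unset Printing Implicit Defensive.
Import Order.TTheory GRing.Theory Num.Theory.
Import numFieldNormedType.Exports.
Local Open Scope classical_set_scope.
Local Open Scope ring_scope.

(** * Charges determined by an algebra of sets *)

(** The window must not shrink with Q: a test function of height one supported near Q has an L^2
    norm of order |Q|^(1/2), too large for a bound by |Q|. Spreading the mass int b of each factor
    over an interval of length 2 gives functions of height O(int b) on a set of volume O(1), whose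
    L^2 norms are linear in int b. The price is up to one derivative in each variable, whence the
    mixed derivatives d^al g with al in {0,1}^(n+1). The passage from cells to points uses no
    differentiation of integrals. With L the bound on the averages, the density g - L restricted to
    a cell of side 1 defines a finite charge, nonpositive on all dyadic cells; approximation in
    total variation makes it nonpositive on every measurable set, in particular on the part of the
    cell where g > L. A bound on |g|_oo that is affine in |f|_W is enough because log^+ turns it
    into a constant plus log^+ |f|_W, and sqrt x <= 1 + x then removes the exponent 1/2. *)

Section approximation.
Local Open Scope ereal_scope.
Context d (T : measurableType d) (R : realType).

(** Closure of [G] among the measurable sets, for the pseudometric that measures the symmetric
    difference. *)
Definition approximable (mu : set T -> \bar R) (G : set (set T)) : set (set T) :=
  [set A | measurable A /\
    forall e : R, (0 < e)%R -> exists2 U, G U & mu (A `\` U `|` U `\` A) < e%:E].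

Lemma approximable_setU (mu : {measure set T -> \bar R}) G A B :
  G `<=` measurable -> setU_closed G ->
  approximable mu G A -> approximable mu G B -> approximable mu G (A `|` B).
Proof.
move=> mG GU [mA hA] [mB hB]; split; first exact: measurableU.
move=> e e0; have e2 : (0 < e / 2)%R by rewrite divr_gt0.
have [U GU' hU] := hA _ e2; have [V GV hV] := hB _ e2.
exists (U `|` V); first exact: GU.
have mU := mG _ GU'; have mV := mG _ GV.
have mAU : measurable (A `\` U `|` U `\` A).
  by apply: measurableU; exact: measurableD.
have mBV : measurable (B `\` V `|` V `\` B).
  by apply: measurableU; exact: measurableD.
apply: (@le_lt_trans _ _ (mu ((A `\` U `|` U `\` A) `|` (B `\` V `|` V `\` B)))).
  apply: le_measure; rewrite ?inE.
  - by apply: measurableU; apply: measurableD; exact: measurableU.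
  - exact: measurableU.
  - move=> x [[[Ax|Bx] /not_orP[nU nV]]|[[Ux|Vx] /not_orP[nA nB]]].
    + by left; left.
    + by right; left.
    + by left; right.
    + by right; right.
apply: le_lt_trans (measureU2 _ mAU mBV) _.
by rewrite (splitr e) EFinD lteD.
Qed.

(* Continuity of mu reduces a countable union to a finite one. *)
Lemma approximable_sigma_algebra (mu : {measure set T -> \bar R}) G :
  mu setT < +oo -> G `<=` measurable -> G set0 -> setC_closed G ->
  setU_closed G -> sigma_algebra setT (approximable mu G).
Proof.
move=> muT mG G0 GC GU.
have S0 : approximable mu G set0.
  split=> // e e0; exists set0 => //.
  by rewrite setDv setUid measure0.
split=> //.
  move=> A [mA hA]; split; first exact: measurableD.
  move=> e e0; have [U GU' hU] := hA _ e0; exists (~` U); first exact: GC.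
  rewrite setTD (_ : _ `|` _ = A `\` U `|` U `\` A)//.
  apply/seteqP; split=> x.
    by move=> [[nA /contrapT Ux]|[nU /contrapT Ax]]; [right|left].
  by move=> [[Ax nU]|[Ux nA]]; [right|left]; split=> // h; apply: h.
move=> A SA; pose B n := \big[setU/set0]_(i < n) A i.
have SB n : approximable mu G (B n).
  rewrite /B; elim: n => [|n ih]; first by rewrite big_ord0.
  by rewrite big_ord_recr/=; exact: approximable_setU.
have mA i : measurable (A i) by have [] := SA i.
have mB i : measurable (B i) by have [] := SB i.
have mUA : measurable (\bigcup_k A k) by exact: bigcup_measurable.
split=> // e e0; have e2 : (0 < e / 2)%R by rewrite divr_gt0.
have Bcup : \bigcap_n (\bigcup_k A k `\` B n) = set0.
  rewrite -subset0 => x xI; have [[i _ Ai] _] := xI 0%N I.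
  have [_] := xI i.+1 I; apply; rewrite /B big_ord_recr/=; by right.
have cB : mu (\bigcup_k A k `\` B n) @[n --> \oo] --> 0.
  rewrite -(measure0 mu) -Bcup.
  apply: (nonincreasing_cvg_mu (F := fun n => \bigcup_k A k `\` B n)).
  - apply: le_lt_trans muT; apply: le_measure; rewrite ?inE//.
    exact: measurableD.
  - by move=> i; exact: measurableD.
  - by rewrite Bcup.
  - move=> m n mn; apply/subsetPset; apply: setDS.
    by apply: subset_bigsetU.
have [N _ HN] : \forall n \near \oo, mu (\bigcup_k A k `\` B n) < (e / 2)%:E.
  by apply: (cB [set y | y < (e / 2)%:E]); apply: open_ereal_lt'; rewrite lte_fin.
have [_ /(_ _ e2)[U GU' hU]] := SB N.
exists U => //; have mU := mG _ GU'.
have m1 : measurable (\bigcup_k A k `\` B N) by exact: measurableD.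
have m2 : measurable (B N `\` U `|` U `\` B N).
  by apply: measurableU; exact: measurableD.
apply: (@le_lt_trans _ _
    (mu ((\bigcup_k A k `\` B N) `|` (B N `\` U `|` U `\` B N)))).
  apply: le_measure; rewrite ?inE.
  - by apply: measurableU; exact: measurableD.
  - exact: measurableU.
  - move=> x [[Ax nU]|[Ux nA]].
    + by have [Bx|nB] := pselect (B N x); [right; left|left].
    + right; right; split=> // Bx; apply: nA.
      by move: Bx; rewrite /B -bigcup_mkord => -[i /= _ Ai]; exists i.
apply: le_lt_trans (measureU2 _ m1 m2) _.
by rewrite (splitr e) EFinD lteD//; apply: HN => /=.
Qed.

(** Every set A of the generated sigma-algebra is approximable by some U in [G] for the total
    variation of [nu], which is finite. Since nu A - nu U = nu (A \ U) - nu (U \ A) is at most the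
    variation of the symmetric difference, nu A <= e for every e > 0. *)
Lemma charge_le0_generated (nu : {charge set T -> \bar R}) G :
  G `<=` measurable -> G set0 -> setC_closed G -> setU_closed G ->
  (forall U, G U -> nu U <= 0) ->
  forall A, <<s G >> A -> nu A <= 0.
Proof.
move=> mG G0 GC GU nuG A sA.
have [P [N PN]] := Hahn_decomposition nu.
have fin : charge_variation PN setT < +oo.
  by rewrite /charge_variation lte_add_pinfty// ltey_eq fin_num_measure.
have SA := smallest_sub (approximable_sigma_algebra fin mG G0 GC GU).
have {SA} [mA hA] : approximable (charge_variation PN) G A.
  apply: SA sA => U GU'; split; first exact: mG.
  by move=> e e0; exists U => //; rewrite setDv setUid measure0.
apply/lee_addgt0Pr => e e0; rewrite add0e.
have [U GU' hU] := hA _ e0; have mU := mG _ GU'.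
have mAU : measurable (A `\` U) by exact: measurableD.
have mUA : measurable (U `\` A) by exact: measurableD.
have := nuG _ GU'.
rewrite (chargeDI nu mA mU) (chargeDI nu mU mA) setIC => h.
have := abse_charge_variation PN mAU.
have := abse_charge_variation PN mUA.
move: hU; rewrite measureU//; last first.
  by rewrite -subset0 => x [[? ?] []].
have mI : measurable (A `&` U) by exact: measurableI.
have pE := fineK (fin_num_measure (charge_variation PN) _ mAU).
have qE := fineK (fin_num_measure (charge_variation PN) _ mUA).
move: h; rewrite -(fineK (fin_num_measure nu _ mAU)).
rewrite -(fineK (fin_num_measure nu _ mUA)) -(fineK (fin_num_measure nu _ mI)).
rewrite -pE -qE -!EFinD !lee_fin lte_fin => h1 h2.
rewrite -[X in (_ <= X -> _)%E]qE -[X in (_ -> _ <= X -> _)%E]pE !abse_EFin !lee_fin.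
move: h1 h2.
set a := fine _; set b := fine _; set p := fine _; set q := fine _.
set r := fine _.
have := ler_norm r; have := ler_norm (- a); rewrite normrN; lra.
Qed.

End approximation.

(** * Charges and refining sequences of countable partitions *)

Section saturated.
Context d (T : measurableType d) (C : countType) (c : nat -> T -> C).
Hypothesis mc : forall k a, measurable (c k @^-1` [set a]).
Hypothesis refine_c : forall k x y, c k.+1 x = c k.+1 y -> c k x = c k y.

(** [c k] labels the cells of the k-th partition; a saturated set is a union of cells of one common
    level. As the partitions refine one another, two levels can be replaced by the larger one, so
    these sets form an algebra. *)
Definition saturated : set (set T) :=
  [set U | exists k, forall x y, c k x = c k y -> U x -> U y].

Let refine_c_le k l x y : (k <= l)%N -> c l x = c l y -> c k x = c k y.
Proof.
by elim: l => [|l ih]; [rewrite leqn0 => /eqP->|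
  rewrite leq_eqVlt => /predU1P[->//|/ih h /refine_c/h]].
Qed.

Lemma saturated0 : saturated set0. Proof. by exists 0%N. Qed.

Lemma saturatedC : setC_closed saturated.
Proof. by move=> U [k kU]; exists k => x y xy nUx Uy; apply: nUx; exact: (kU y). Qed.

Lemma saturatedU : setU_closed saturated.
Proof.
move=> U V [k kU] [l lV]; exists (maxn k l) => x y xy [Ux|Vx].
- by left; apply: (kU x) Ux; apply: refine_c_le xy; rewrite leq_maxl.
- by right; apply: (lV x) Vx; apply: refine_c_le xy; rewrite leq_maxr.
Qed.

(** Countable additivity is stated for sequences, so the labels are enumerated through their codes;
    an integer that codes no label contributes the empty set. When [U] is saturated at level [k],
    each term is empty or a whole cell. *)
Let cell (U : set T) k i : set T :=
  if pickle_inv i is Some a then c k @^-1` [set a] `&` U else set0.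

Let cell_cases U k i : (forall x y, c k x = c k y -> U x -> U y) ->
  cell U k i = set0 \/ exists a, cell U k i = c k @^-1` [set a].
Proof.
move=> kU; rewrite /cell; case: pickle_inv => [a|]; last by left.
have [[x [xa Ux]]|h] := pselect (exists x, c k x = a /\ U x).
  right; exists a; apply/seteqP; split=> [y []//|y ya]; split=> //.
  by apply: (kU x) => //; rewrite ya.
by left; rewrite -subset0 => y [ya Uy]; apply: h; exists y.
Qed.

Let cellE U k : (forall x y, c k x = c k y -> U x -> U y) ->
  [/\ forall i, measurable (cell U k i), trivIset setT (cell U k) &
  \bigcup_i cell U k i = U].
Proof.
move=> kU; split.
- by move=> i; have [->|[a ->]] := cell_cases i kU.
- move=> i j _ _ [x []]; rewrite /cell.
  case: (pickle_inv i) (@pickle_invK C i) => [a|//] /= <- [<- _].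
  by case: (pickle_inv j) (@pickle_invK C j) => [b|//] /= <- [<- _].
- apply/seteqP; split=> x.
    by move=> [i _]; rewrite /cell; case: pickle_inv => // a [].
  by move=> Ux; exists (pickle (c k x)) => //; rewrite /cell pickleK_inv.
Qed.

Lemma saturated_measurable : saturated `<=` measurable.
Proof. by move=> U [k /cellE[mcell _ <-]]; exact: bigcup_measurable. Qed.

(** A saturated set is a countable disjoint union of cells, so the sign on cells passes to the
    algebra by countable additivity, then to the sigma-algebra by approximation. *)
Lemma charge_le0_cells (R : realType) (nu : {charge set T -> \bar R}) :
  (forall k a, nu (c k @^-1` [set a]) <= 0)%E ->
  forall A, <<s saturated >> A -> (nu A <= 0)%E.
Proof.
move=> nu0; apply: charge_le0_generated.
- exact: saturated_measurable.
- exact: saturated0.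
- exact: saturatedC.
- exact: saturatedU.
move=> U [k kU]; have [mcell tcell cellU] := cellE kU.
have := charge_semi_sigma_additive _ mcell tcell (bigcup_measurable (fun i _ => mcell i)).
rewrite cellU => h; apply: (cvge_to_le (h _ nu)); apply: nearW => n.
apply: sume_le0 => i _; have [->|[a ->]] := cell_cases i kU => //.
by rewrite charge0.
Qed.

End saturated.

(** * Dyadic cells *)

Section lebesgue_rV_box.
Context {R : realType}.

Definition rV_box k (I : 'I_k -> set R) : set 'rV[R]_k :=
  [set v | forall i, I i (v ord0 i)].

Lemma measurable_rV_box k (I : 'I_k -> set R) :
  (forall i, measurable (I i)) -> measurable (rV_box I).
Proof.
move=> mI; rewrite (_ : rV_box I = \bigcap_i [set v : 'rV[R]_k | I i (v ord0 i)]).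
  apply: fin_bigcap_measurable => // i _.
  by rewrite -[X in measurable X]setTI; exact: (measurable_coor i measurableT (mI i)).
by apply/seteqP; split=> [v h i _|v h i]; exact: h.
Qed.

Lemma lebesgue_rV_box k (I : 'I_k -> set R) : (forall i, measurable (I i)) ->
  lebesgue_rV k (rV_box I) = (\prod_(i < k) lebesgue_measure (I i))%E.
Proof.
elim: k I => [|k ih] I mI.
  rewrite big_ord0 (_ : rV_box I = setT); last by rewrite -subTset => v _ [].
  exact: diracT.
rewrite big_ord_recl/= -ih//.
rewrite -product_measure1E; [|exact: (mI ord0)|exact: measurable_rV_box].
rewrite /lebesgue_rV_step /pushforward; congr (_ _).
apply/seteqP; split => [[x v] /= h|[x v] /= [hx hv] i].
  split; first by have := h ord0; rewrite /rV_cons mxE unlift_none.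
  by move=> i; have := h (lift ord0 i); rewrite /rV_cons mxE liftK.
by rewrite /rV_cons mxE; case: unliftP => [j ->|->] //=; exact: hv.
Qed.

Definition dyadic_cell k d (v : 'rV[R]_d) : {ffun 'I_d -> int} :=
  [ffun i => Num.floor (2 ^+ k * v ord0 i)].

Lemma dyadic_cell_preimage k d (a : {ffun 'I_d -> int}) :
  @dyadic_cell k d @^-1` [set a] =
  rV_box (fun i => `[(a i)%:~R / 2 ^+ k, (a i)%:~R / 2 ^+ k + 2 ^- k[%classic).
Proof.
have p0 : 0 < 2 ^+ k :> R by rewrite exprn_gt0.
have E (x : R) (m : int) : (Num.floor (2 ^+ k * x) == m) =
    (m%:~R / 2 ^+ k <= x < m%:~R / 2 ^+ k + 2 ^- k).
  rewrite floor_eq ler_pdivrMr// [x * _]mulrC; congr andb.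
  rewrite (_ : _ / _ + _ = (m + 1)%:~R / 2 ^+ k); last by rewrite intrD mulrDl mul1r.
  by rewrite ltr_pdivlMr// mulrC.
apply/seteqP; split=> v.
  by move=> /= <- i; rewrite ffunE /= in_itv/= -E.
move=> h; apply/ffunP => i; rewrite ffunE; apply/eqP; rewrite E.
by have := h i; rewrite /= in_itv.
Qed.

Lemma measurable_dyadic_cell k d (a : {ffun 'I_d -> int}) :
  measurable (@dyadic_cell k d @^-1` [set a]).
Proof. by rewrite dyadic_cell_preimage; exact: measurable_rV_box. Qed.

(** The floor of 2y determines that of y: if 2y and 2z have the same floor, then 2 floor(y) <=
    floor(2y) = floor(2z) <= 2z, hence floor(y) <= floor(z), and conversely by symmetry. *)
Lemma dyadic_cell_refine k d (u v : 'rV[R]_d) :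
  dyadic_cell k.+1 u = dyadic_cell k.+1 v -> dyadic_cell k u = dyadic_cell k v.
Proof.
have le (y z : R) : Num.floor (2 * y) = Num.floor (2 * z) ->
    Num.floor y <= Num.floor z.
  move=> yz; rewrite floor_ge_int.
  have : 2 * Num.floor y <= Num.floor (2 * y).
    by rewrite floor_ge_int intrM ler_pM2l// floor_le.
  by rewrite yz floor_ge_int intrM ler_pM2l.
move=> uv; apply/ffunP => i; rewrite !ffunE.
have := congr1 (fun f : {ffun 'I_d -> int} => f i) uv.
rewrite !ffunE exprS -!mulrA => h.
by apply/eqP; rewrite eq_le !le.
Qed.

(** A closed half-line condition v_i >= r is equivalent to floor(2^k v_i) >= floor(2^k r) for all k,
    and the k-th of these conditions is saturated at level k. *)
Lemma dyadic_cell_generate d :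
  (measurable : set (set 'rV[R]_d)) `<=` <<s saturated (fun k => @dyadic_cell k d) >>.
Proof.
set S := saturated _.
have mcoor (i : 'I_d) : measurable_fun [set: g_sigma_algebraType S]
    (fun v : 'rV[R]_d => v ord0 i : measurableTypeR R).
  apply: (measurability (@measurable_realfun.RGenCInfty.G R)) => [|/= _ [_] [r] -> <-].
    exact: measurable_realfun.RGenCInfty.measurableE.
  rewrite setTI.
  have -> : (fun v : 'rV[R]_d => v ord0 i) @^-1` `[r, +oo[ = \bigcap_k
      [set v | Num.floor (2 ^+ k * r) <= Num.floor (2 ^+ k * v ord0 i)]; last first.
    apply: (@bigcap_measurable _ (g_sigma_algebraType S)) => // k _.
    apply: sub_sigma_algebra.
    exists k => u v uv /=.
    have := congr1 (fun f : {ffun 'I_d -> int} => f i) uv.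
    by rewrite !ffunE => ->.
  apply/seteqP; split=> v /=.
    rewrite in_itv/= andbT => rv k _ /=.
    by apply: le_floor; rewrite ler_pM2l// exprn_gt0.
  rewrite in_itv/= andbT => h; rewrite leNgt; apply/negP => vr.
  (* At a scale 2^-N smaller than r - v_i, the numbers 2^N v_i and 2^N r are more than 1 apart, so
     their floors differ. *)
  pose N := (Num.trunc (r - v ord0 i)^-1).+1.
  have N2 : (r - v ord0 i)^-1 < 2 ^+ N.
    apply: lt_le_trans (truncnS_gt _) _.
    by rewrite -natrX ler_nat ltnW// ltn_expl.
  have := h N I; rewrite /= leNgt => /negP; apply.
  rewrite -lezD1 floor_ge_int.
  rewrite intrD (@le_trans _ _ (2 ^+ N * v ord0 i + 1))//.
    by rewrite lerD2r floor_le.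
  rewrite -lerBrDl -mulrBr -ler_pdivrMr ?subr_gt0// mul1r ltW//.
apply: smallest_sub; first exact: smallest_sigma_algebra.
rewrite -bigcup_seq => _ [i _ [Y mY <-]].
by have := mcoor i measurableT Y mY.
Qed.

End lebesgue_rV_box.

(** * From averages over dyadic cells to almost every point *)

Section ae_bound.
Context {R : realType}.

Lemma lebesgue_rV_dyadic_cell d k (a : {ffun 'I_d -> int}) :
  lebesgue_rV d (@dyadic_cell R k d @^-1` [set a]) = (2 ^- k ^+ d)%:E.
Proof.
rewrite dyadic_cell_preimage lebesgue_rV_box//.
under eq_bigr => i _.
  rewrite lebesgue_measure_itv/= lte_fin ltrDl invr_gt0 exprn_gt0//.
  rewrite -EFinD addrAC subrr add0r.
  over.
by rewrite prodEFin prodr_const card_ord.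
Qed.

(** The space is cut into the countably many cells of level 0, on each of which g - M is integrable
    and defines a charge. This charge is nonpositive on the part of the cell where g > M, although
    its density is positive there: that part is negligible. *)
Lemma ae_le_dyadic_cells d (g : 'rV[R]_d -> R) (M : R) :
  let mu := @lebesgue_rV R d in
  (forall k a, mu.-integrable (@dyadic_cell R k d @^-1` [set a]) (EFin \o g)) ->
  (forall k a, \int[mu]_(z in @dyadic_cell R k d @^-1` [set a]) (g z)%:E <=
    M%:E * mu (@dyadic_cell R k d @^-1` [set a]))%E ->
  {ae mu, forall z, g z <= M}.
Proof.
move=> mu ig gM.
pose cell k a := @dyadic_cell R k d @^-1` [set a].
have mcell k a : measurable (cell k a) by exact: measurable_dyadic_cell.
have icst k a (r : R) : mu.-integrable (cell k a) (EFin \o cst r).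
  apply/integrableP; split; first by apply/measurable_EFinP; exact: measurable_cst.
  by rewrite /= integral_cst//= lebesgue_rV_dyadic_cell -EFinM ltry.
have igM k a : mu.-integrable (cell k a) (EFin \o (g \- cst M)).
  exact: (integrableB (mcell k a) (ig k a) (icst k a M)).
pose A a : set 'rV[R]_d := cell 0%N a `&` [set z | M < g z].
suff A0 a : mu.-negligible (A a).
  apply: (@negligibleS _ _ _ mu (\bigcup_i
      if pickle_inv i is Some a then A a else set0)).
    move=> z /= /negP; rewrite -ltNge => Mg.
    exists (pickle (@dyadic_cell R 0 d z)) => //.
    by rewrite pickleK_inv.
  apply: negligible_bigcup => i; case: pickle_inv => [a|]; first exact: A0.
  exact: negligible_set0.
have ih : mu.-integrable setT ((EFin \o (g \- cst M)) \_ (cell 0%N a)).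
  by apply/(integrable_mkcond _ (mcell 0%N a)); exact: igM.
pose nu : {charge set 'rV[R]_d -> \bar R} := induced_charge ih.
have nuE B : nu B = (\int[mu]_(z in B `&` cell 0%N a) (g z - M)%:E)%E.
  by rewrite integral_mkcondr.
have nu_le0 k b : (nu (cell k b) <= 0)%E.
  rewrite nuE.
  (* A dyadic cell is either disjoint from the given cell of level 0 or contained in it. *)
  have [->|->] : cell k b `&` cell 0%N a = set0 \/ cell k b `&` cell 0%N a = cell k b.
    have [[z [zb za]]|h] := pselect (exists z, cell k b z /\ cell 0%N a z); last first.
      by left; rewrite -subset0 => z [zb za]; apply: h; exists z.
    right; apply/seteqP; split=> [y []//|y yb]; split=> //.
    rewrite /cell /= -za; move: yb zb; rewrite /cell/= => <-.
    elim: (k) => [//|l ihl] /esym/dyadic_cell_refine/esym; exact: ihl.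
  - by rewrite integral_set0.
  - have := integralB_EFin (mcell k b) (ig k b) (icst k b M).
    rewrite /= integral_cst// => ->.
    by rewrite sube_le0 ?gM.
have mg : measurable_fun (cell 0%N a) g.
  by have /measurable_int/measurable_EFinP := ig 0%N a.
have mA : measurable (A a).
  rewrite /A (_ : [set _ | _] = g @^-1` `]M, +oo[); last first.
    by apply/seteqP; split=> z /=; rewrite in_itv/= andbT.
  exact: mg.
have := charge_le0_cells mcell (@dyadic_cell_refine R ^~ d) nu_le0.
move=> /(_ (A a) (dyadic_cell_generate mA)).
rewrite nuE (_ : _ `&` _ = A a); last by rewrite /A setIAC setIid.
move=> le0.
have A_ge0 z : A a z -> 0 <= g z - M by move=> [_ /ltW]; rewrite subr_ge0.
have int0 : (\int[mu]_(z in A a) `|(g z - M)%:E| = 0)%E.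
  under eq_integral => z /set_mem Az do rewrite gee0_abs ?lee_fin ?A_ge0//.
  apply/eqP; rewrite eq_le le0/=; apply: integral_ge0 => z Az.
  by rewrite lee_fin A_ge0.
have mgM : measurable_fun (A a) (fun z => (g z - M)%:E).
  apply/measurable_EFinP; apply: measurable_funB; last exact: measurable_cst.
  by apply: measurable_funS mg => // z [].
have := (ae_eq_integral_abs mu mA mgM).1 int0.
apply: negligibleS => z Az /=; apply/not_implyP; split=> //.
by move=> [] /eqP; rewrite gt_eqF// subr_gt0; case: Az.
Qed.

End ae_bound.

(** * Smooth functions of one variable *)

Section smooth1.
Context {R : realType}.
Implicit Types f g u : R -> R.

(** The derivative is an existential witness instead of [derive1 f], so that each closure property
    can exhibit it by its usual formula and recurse on it. *)
Fixpoint derivable_upto k f : Prop :=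
  if k is k'.+1 then
    exists2 f', forall x : R, is_derive x 1 f (f' x) & derivable_upto k' f'
  else True.

Definition smooth1 f := forall k, derivable_upto k f.

Lemma derivable_uptoW k f : derivable_upto k.+1 f -> derivable_upto k f.
Proof. by elim: k f => // k ih f [f' ff' /ih f'k]; exists f'. Qed.

Lemma is_derive1_fun f f' : (forall x : R, is_derive x 1 f (f' x)) -> derive1 f = f'.
Proof. by move=> ff'; apply/funext => x; rewrite derive1E; apply: derive_val. Qed.

Lemma derivable_uptoD k f g :
  derivable_upto k f -> derivable_upto k g -> derivable_upto k (f \+ g).
Proof.
elim: k f g => // k ih f g [f' ff' f'k] [g' gg' g'k].
exists (f' \+ g'); last exact: ih.
by move=> x; exact: is_deriveD.
Qed.

Lemma derivable_uptoM k f g :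
  derivable_upto k f -> derivable_upto k g -> derivable_upto k (f \* g).
Proof.
elim: k f g => // k ih f g fk gk; move: (fk) (gk) => [f' ff' f'k] [g' gg' g'k].
exists ((f \* g') \+ (g \* f')).
  by move=> x; apply: is_derive_eq.
by apply: derivable_uptoD; apply: ih => //; exact: derivable_uptoW.
Qed.

Lemma derivable_upto_cst k (a : R) : derivable_upto k (cst a).
Proof.
elim: k a => // k ih a; exists (cst 0) => // x; exact: is_derive_cst.
Qed.

Lemma derivable_upto_expR k u : derivable_upto k u -> derivable_upto k (expR \o u).
Proof.
elim: k u => // k ih u uk; move: (uk) => [u' uu' u'k].
exists ((expR \o u) \* u').
  by move=> x; apply: is_derive1_comp.
by apply: derivable_uptoM => //; apply: ih; exact: derivable_uptoW.
Qed.

Lemma derivable_upto_affine k f (a b : R) : derivable_upto k f ->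
  derivable_upto k (fun x => f (a * x + b)).
Proof.
elim: k f => // k ih f [f' ff' f'k].
exists ((fun x => f' (a * x + b)) \* cst a).
  move=> x; apply: (@is_derive1_comp _ f (fun x => a * x + b)) => //.
  apply: (@is_derive_eq _ _ _ (a \*: id + cst b)).
  by rewrite addr0 /= [_ *: _]mulr1.
by apply: derivable_uptoM; [exact: ih|exact: derivable_upto_cst].
Qed.

Lemma smooth1_derivable f (x : R) : smooth1 f -> derivable f x 1.
Proof. by move=> /(_ 1%N)[f' ff' _]. Qed.

Lemma smooth1_is_derive f (x : R) : smooth1 f -> is_derive x 1 f (derive1 f x).
Proof. by move=> /smooth1_derivable h; rewrite derive1E; exact: derivableP. Qed.

Lemma smooth1_continuous f : smooth1 f -> continuous f.
Proof.
move=> sf x; apply: differentiable_continuous; apply/derivable1_diffP.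
exact: smooth1_derivable.
Qed.

Lemma smooth1_derive1 f : smooth1 f -> smooth1 (derive1 f).
Proof. by move=> sf k; have [f' /is_derive1_fun -> ] := sf k.+1. Qed.

Lemma smooth1_iter_derive1 f n : smooth1 f -> smooth1 (iter n (@derive1 R R) f).
Proof. by elim: n => //= n ih sf; apply: smooth1_derive1; exact: ih. Qed.

Lemma smooth1_primitive f f' : (forall x : R, is_derive x 1 f (f' x)) ->
  smooth1 f' -> smooth1 f.
Proof. by move=> ff' sf' [//|k]; exists f'. Qed.

(** The functions x^-n e^(-1/x), extended by 0 to x <= 0. The powers make the family stable under
    differentiation up to linear combinations, so the smoothness of e^(-1/x) is proved for all n at
    once. *)
Definition flat_exp n (x : R) : R := if 0 < x then x^-1 ^+ n * expR (- x^-1) else 0.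

(** With y = 1/x, this is y^(n+2) <= (n+2)! e^y, read off the exponential series. The factor x^2 is
    what makes the difference quotient at 0 tend to 0. *)
Lemma flat_exp_le n x : `|flat_exp n x| <= n.+2`!%:R * x ^+ 2.
Proof.
rewrite /flat_exp; case: ltP => x0; last first.
  by rewrite normr0 mulr_ge0// sqr_ge0.
have y0 : 0 < x^-1 by rewrite invr_gt0.
rewrite ger0_norm ?mulr_ge0 ?expR_ge0 ?exprn_ge0 ?(ltW y0)//.
have : x^-1 ^+ n.+2 <= n.+2`!%:R * expR x^-1.
  have := @expR_ge1Dxn _ _ n.+1 (ltW y0).
  rewrite -lerBrDl ler_pdivrMr ?ltr0n ?fact_gt0// => /le_trans; apply.
  by rewrite mulrC ler_pM2l ?ltr0n ?fact_gt0// gerBl.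
rewrite -ler_pdivrMr ?expR_gt0// -expRN => h.
have -> : x^-1 ^+ n = x^-1 ^+ n.+2 * x ^+ 2.
  by rewrite -addn2 exprD -mulrA -exprMn mulVf ?gt_eqF// expr1n mulr1.
by rewrite (mulrAC (x^-1 ^+ n.+2)) ler_pM2r ?exprn_gt0.
Qed.

Lemma is_derive_flat_exp n (x : R) :
  is_derive x 1 (flat_exp n) (flat_exp n.+2 x - n%:R * flat_exp n.+1 x).
Proof.
have [x0|x0|->] := ltgtP x 0.
- rewrite {2 3}/flat_exp ltNge (ltW x0)/= mulr0 subr0.
  apply: (near_eq_is_derive (f := cst 0)).
  near=> y; rewrite /flat_exp ltNge (ltW (_ : y < 0))//.
  by near: y; exact: lt_nbhsl.
- rewrite {2 3}/flat_exp x0.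
  pose v (y : R) := y^-1.
  have dv : is_derive x 1 v (- x ^- 2).
    apply: DeriveDef; first exact: (derivableV (f := id) (lt0r_neq0 x0)).
    by rewrite (deriveV (f := id) (lt0r_neq0 x0))// derive_id [_ *: _]mulr1.
  have de : is_derive x 1 (expR \o (- v)) (expR (- x^-1) * - - x ^- 2).
    by apply: is_derive1_comp.
  apply: (near_eq_is_derive (f := v ^+ n * (expR \o (- v)))).
    near=> y; have y0 : 0 < y by near: y; exact: lt_nbhsr.
    by rewrite /flat_exp y0 mulrfctE exprfctE.
  apply: is_derive_eq.
  rewrite opprK /= fctE /v; set e := expR _; rewrite -[_ *: _]/(_ * _).
  rewrite /GRing.scale/= -exprVn; move: (x^-1) => y; clearbody e; clear.
  by case: n => [|n] /=; rewrite !exprS ?expr0; ring.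
- rewrite {2 3}/flat_exp ltxx mulr0 subr0.
  have h : (fun h : R => h^-1 *: ((flat_exp n \o shift 0) (h *: 1) - flat_exp n 0))
      @ 0^' --> (0 : R).
    apply/cvgr0Pnorm_le => e e0.
    have c0 : 0 < n.+2`!%:R :> R by rewrite ltr0n fact_gt0.
    near=> h.
    have h0 : h != 0 by near: h; exact: nbhs_dnbhs_neq.
    rewrite /= addr0 [h *: 1]mulr1 {2}/flat_exp ltxx subr0 [_ *: _]mulrC normrM.
    rewrite normfV ler_pdivrMr ?normr_gt0//.
    apply: le_trans (flat_exp_le _ _) _.
    rewrite -[h ^+ 2]real_normK ?num_real// expr2 mulrA ler_pM2r ?normr_gt0//.
    rewrite mulrC -ler_pdivlMr//.
    by near: h; apply: dnbhs0_le; rewrite divr_gt0.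
  by apply: DeriveDef; [exact: cvgP h|exact: cvg_lim h].
Unshelve. all: by end_near. Qed.

Lemma smooth1_flat_exp : smooth1 (flat_exp 0).
Proof.
move=> k; elim: k 0%N => // k ih n.
exists (fun x => flat_exp n.+2 x - n%:R * flat_exp n.+1 x).
  exact: is_derive_flat_exp.
rewrite (_ : (fun _ => _) = flat_exp n.+2 \+ (cst (- n%:R) \* flat_exp n.+1)).
  apply: derivable_uptoD => //; apply: derivable_uptoM => //.
  exact: derivable_upto_cst.
by apply/funext => x /=; rewrite mulNr.
Qed.

End smooth1.

(** * Primitives of bumps and the one-dimensional decomposition *)

Section cutoff.
Context {R : realType}.
Implicit Types f F : R -> R.

Lemma is_derive1_ndecr f F : (forall x : R, is_derive x 1 F (f x)) ->
  (forall x, 0 <= f x) -> {homo F : x y / x <= y}.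
Proof.
move=> Ff f0 x y xy.
have cF : {within `[x, y], continuous F}.
  apply: continuous_subspaceT => z; apply: differentiable_continuous.
  by apply/derivable1_diffP; exact: (@ex_derive _ _ _ _ _ _ _ (Ff z)).
have [c _] := MVT_segment xy (fun z _ => Ff z) cF.
by rewrite -subr_ge0 => ->; rewrite mulr_ge0// subr_ge0.
Qed.

Lemma is_derive1_increment f F x y (M : R) : (forall x : R, is_derive x 1 F (f x)) ->
  x <= y -> (forall z, z \in `[x, y] -> f z <= M) -> F y - F x <= M * (y - x).
Proof.
move=> Ff xy fM.
have cF : {within `[x, y], continuous F}.
  apply: continuous_subspaceT => z; apply: differentiable_continuous.
  by apply/derivable1_diffP; exact: (@ex_derive _ _ _ _ _ _ _ (Ff z)).
have [c cxy ->] := MVT_segment xy (fun z _ => Ff z) cF.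
by rewrite ler_wpM2r ?subr_ge0 ?fM.
Qed.

Lemma primitive_from f (a : R) : continuous f -> (forall x, x <= a -> f x = 0) ->
  exists2 F, forall x : R, is_derive x 1 F (f x) & forall x, x <= a -> F x = 0.
Proof.
move=> cf f0.
(* Starting at a - 1 adds nothing to the integral, as f vanishes up to a, and puts every x >= a
   strictly to the right of the lower end point, where the fundamental theorem of calculus
   applies. *)
pose F x := (\int[lebesgue_measure]_(t in `[a - 1, x]) f t)%R.
have F0 x : x <= a -> F x = 0.
  move=> xa; rewrite /F (eq_Rintegral _ (g := cst 0)) ?Rintegral_cst ?mul0r//.
  move=> t; rewrite inE/= in_itv/= => /andP[_ tx].
  by rewrite f0// (le_trans tx).
exists F => // x; have [xa|ax] := ltP x a.
  rewrite f0 ?ltW//; apply: (near_eq_is_derive (f := cst 0)).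
  near=> y; rewrite F0// ltW//.
  by near: y; exact: lt_nbhsl.
have [] := @continuous_FTC1_closed R f (a - 1) x (x + 1).
- by rewrite ltrDl.
- apply: continuous_compact_integrable; first exact: segment_compact.
  exact: continuous_subspaceT.
- by rewrite ltrBlDr (le_lt_trans ax)// ltrDl.
- exact: cf.
by move=> dF FE; apply: DeriveDef; [exact: dF|rewrite -derive1E FE].
Unshelve. all: by end_near. Qed.

Definition flat_bump (a b x : R) : R := flat_exp 0 (x - a) * flat_exp 0 (b - x).

Lemma flat_exp0_ge0 (x : R) : 0 <= flat_exp 0 x.
Proof. by rewrite /flat_exp; case: ifP => // _; rewrite mul1r expR_ge0. Qed.

Lemma flat_exp0_le1 (x : R) : flat_exp 0 x <= 1.
Proof.
rewrite /flat_exp; case: ifPn => // x0.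
by rewrite mul1r expR_le1 oppr_le0 invr_ge0 ltW.
Qed.

Lemma flat_exp0_gt0 (x : R) : 0 < x -> 0 < flat_exp 0 x.
Proof. by rewrite /flat_exp => ->; rewrite mul1r expR_gt0. Qed.

Lemma flat_exp0_eq0 (x : R) : x <= 0 -> flat_exp 0 x = 0.
Proof. by rewrite /flat_exp ltNge => ->. Qed.

Lemma flat_exp0_ndecr : {homo @flat_exp R 0 : x y / x <= y}.
Proof.
move=> x y xy; have [x0|x0] := leP x 0.
  by rewrite flat_exp0_eq0// flat_exp0_ge0.
rewrite /flat_exp x0 (lt_le_trans x0 xy) !mul1r ler_expR lerN2 lef_pV2 ?posrE//.
exact: lt_le_trans xy.
Qed.

Lemma smooth1_flat_bump a b : smooth1 (flat_bump a b).
Proof.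
move=> k; apply: derivable_uptoM.
- rewrite (_ : (fun _ => _) = fun x => flat_exp 0 (1 * x + - a)); last first.
    by apply/funext => x; rewrite mul1r.
  exact/derivable_upto_affine/smooth1_flat_exp.
- rewrite (_ : (fun _ => _) = fun x => flat_exp 0 (-1 * x + b)); last first.
    by apply/funext => x; rewrite mulN1r addrC.
  exact/derivable_upto_affine/smooth1_flat_exp.
Qed.

Lemma flat_bump_ge0 a b x : 0 <= flat_bump a b x.
Proof. by rewrite mulr_ge0// flat_exp0_ge0. Qed.

Lemma flat_bump_le1 a b x : flat_bump a b x <= 1.
Proof. by rewrite mulr_ile1 ?flat_exp0_ge0 ?flat_exp0_le1. Qed.

Lemma flat_bump_eq0l a b x : x <= a -> flat_bump a b x = 0.
Proof. by move=> xa; rewrite /flat_bump flat_exp0_eq0 ?mul0r// subr_le0. Qed.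

Lemma flat_bump_eq0r a b x : b <= x -> flat_bump a b x = 0.
Proof. by move=> bx; rewrite /flat_bump [X in _ * X]flat_exp0_eq0 ?mulr0// subr_le0. Qed.

(** [F b] plays the role of the integral of [f]; all the bounds come from the mean value theorem
    applied to [F]. *)
Lemma bump_primitive f (a b : R) : smooth1 f -> a <= b -> (forall x, 0 <= f x <= 1) ->
  (forall x, x <= a -> f x = 0) -> (forall x, b <= x -> f x = 0) ->
  exists F, [/\ forall x : R, is_derive x 1 F (f x), forall x, x <= a -> F x = 0,
    forall x, b <= x -> F x = F b, forall x, 0 <= F x <= F b & F b <= b - a].
Proof.
move=> sf ab f01 fa fb.
have [F dF F0] := primitive_from (smooth1_continuous sf) fa.
have ndF : {homo F : x y / x <= y}.
  by apply: is_derive1_ndecr dF _ => x; have /andP[] := f01 x.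
have Fb x : b <= x -> F x = F b.
  move=> bx; apply/eqP; rewrite eq_le (ndF _ _ bx) andbT -subr_le0.
  rewrite -(mul0r (x - b)); apply: is_derive1_increment => // z.
  by rewrite in_itv/= => /andP[bz _]; rewrite fb.
have F_ge0 x : 0 <= F x.
  by have [/F0 ->//|/ltW ax] := leP x a; rewrite -(F0 a)// ndF.
exists F; split => //.
- by move=> x; rewrite F_ge0/=; have [bx|/ltW xb] := leP b x; [rewrite Fb|exact: ndF].
- rewrite -[F b]subr0 -(F0 a)// -[leRHS]mul1r; apply: is_derive1_increment => // z _.
  by have /andP[] := f01 z.
Qed.

Lemma smooth_step : exists H : R -> R, exists K : R,
  [/\ smooth1 H, forall x, x <= 0 -> H x = 0, forall x, 1 <= x -> H x = 1,
      forall x, 0 <= H x <= 1 & forall x, `|derive1 H x| <= K].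
Proof.
have [] := @bump_primitive (flat_bump 0 1) 0 1 => //.
- exact: smooth1_flat_bump.
- by move=> x; rewrite flat_bump_ge0 flat_bump_le1.
- by move=> x; exact: flat_bump_eq0l.
- by move=> x; exact: flat_bump_eq0r.
move=> F [dF F0 F1 F01 _].
have cF : {within `[0, 1], continuous F}.
  apply: continuous_subspaceT => z; apply: differentiable_continuous.
  by apply/derivable1_diffP; exact: (@ex_derive _ _ _ _ _ _ _ (dF z)).
have c0 : 0 < F 1.
  (* The normalising constant F 1 equals the value of the bump at an interior point, hence is
     positive. *)
  have [c] := MVT ltr01 (fun z _ => dF z) cF.
  rewrite in_itv/= => /andP[c0 c1].
  rewrite (F0 0)// !subr0 mulr1 => ->.
  by rewrite mulr_gt0// flat_exp0_gt0// subr_gt0.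
have dH x : is_derive (x : R) 1 ((F 1)^-1 \*: F) ((F 1)^-1 * flat_bump 0 1 x).
  exact: is_deriveZ.
have sH : smooth1 ((F 1)^-1 \*: F).
  apply: smooth1_primitive dH _ => k.
  apply: derivable_uptoM; [exact: derivable_upto_cst|exact: smooth1_flat_bump].
exists ((F 1)^-1 \*: F), (F 1)^-1; split=> //=.
- by move=> x x0; rewrite (F0 x)// scaler0.
- by move=> x x1; rewrite (F1 x)// [_ *: _]mulVf// gt_eqF.
- move=> x; have /andP[h0 h1] := F01 x.
  by rewrite [_ *: _]mulrC divr_ge0 ?(ltW c0)//= ler_pdivrMr// mul1r.
- move=> x; rewrite (is_derive1_fun dH).
  rewrite ger0_norm ?mulr_ge0 ?invr_ge0 ?(ltW c0) ?flat_exp0_ge0//.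
  by rewrite ler_piMr ?invr_ge0 ?(ltW c0)// flat_bump_le1.
Qed.

(* beta - (int beta) H'(. - a) has integral 0, hence is the derivative of a
   compactly supported function. *)
Lemma bump_decomposition : exists2 K : R, 0 <= K &
  forall (a b : R) beta, a <= b <= a + 2 -> smooth1 beta ->
    (forall x, 0 <= beta x <= 1) ->
    (forall x, x <= a -> beta x = 0) -> (forall x, b <= x -> beta x = 0) ->
    exists theta : bool -> R -> R,
    [/\ forall i, smooth1 (theta i),
        forall x, beta x = derive1 (theta true) x + theta false x,
        forall i x, `|theta i x| <= K * (b - a) &
        forall i x, x \notin `[a, a + 2] -> theta i x = 0].
Proof.
have [H [K [sH H0 H1 H01 HK]]] := smooth_step.
have K0 : 0 <= K by exact: le_trans (HK 0).
exists (1 + K); first by rewrite addr_ge0.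
move=> a b beta /andP[ab ba2] sb b01 b0a b0b.
have [F [dF F0 F1 F01 Fba]] := bump_primitive sb ab b01 b0a b0b.
pose H' x := derive1 H (x - a); pose c := F b.
have c0 : 0 <= c by have /andP[] := F01 b.
pose Ha x := H (x - a).
have dHa x : is_derive (x : R) 1 Ha (H' x).
  have := @is_derive1_comp _ H (fun y => y - a) x _ _
    (smooth1_is_derive (x - a) sH) (is_derive_shift x 1 (- a)).
  by rewrite [_ * 1]mulr1.
have sH' : smooth1 H'.
  move=> k; rewrite (_ : H' = fun x => derive1 H (1 * x + - a)).
    by apply: derivable_upto_affine; exact: smooth1_derive1.
  by apply/funext => x; rewrite mul1r.
(* Both terms take values in [0, c], vanish to the left of a and equal c to the right of a + 2.
   Hence [psi] is bounded by c <= b - a and supported in the window. *)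
pose psi := F - (c \*: Ha).
have dpsi x : is_derive (x : R) 1 psi (beta x - c * H' x).
  exact: is_deriveB.
have scH' : smooth1 (c \*: H').
  move=> k; exact: (derivable_uptoM (derivable_upto_cst k c) (sH' k)).
(* The boolean index is the number of derivatives that the decomposition applies to the function. *)
exists (fun i => if i then psi else c \*: H'); split.
- case=> //.
  apply: smooth1_primitive dpsi _ => k.
  rewrite (_ : (fun _ => _) = beta \+ (cst (- 1) \* (c \*: H'))); last first.
    by apply/funext => x /=; rewrite mulN1r.
  apply: derivable_uptoD => //; apply: derivable_uptoM => //.
  exact: derivable_upto_cst.
- by move=> x; rewrite (is_derive1_fun dpsi) subrK.
- have cK : c <= (1 + K) * (b - a).
    by rewrite (le_trans Fba)// mulrDl mul1r lerDl mulr_ge0// subr_ge0.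
  case=> x /=.
    apply: le_trans cK.
    have /andP[p0 p1] := F01 x; have /andP[h0 h1] := H01 (x - a).
    have q0 : 0 <= c * Ha x by rewrite mulr_ge0.
    have q1 : c * Ha x <= c by rewrite ler_piMr.
    rewrite /psi -[(_ - _ : R -> R) x]/(F x - c * Ha x) ler_norml.
    by rewrite /c in q0 q1 *; lra.
  rewrite [_ *: _]mulrC normrM (ger0_norm c0) ler_pM//.
  by apply: le_trans (HK _) _; rewrite lerDr.
- case=> x; rewrite in_itv/= negb_and -!ltNge => /orP[xa|ax] /=.
  + rewrite /psi -[(_ - _ : R -> R) x]/(F x - c * Ha x).
    by rewrite F0 ?ltW// /Ha H0 ?mulr0 ?subr0// subr_le0 ltW.
  + rewrite /psi -[(_ - _ : R -> R) x]/(F x - c * Ha x).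
    rewrite F1 ?(le_trans ba2) ?ltW// /Ha H1 ?mulr1 ?subrr//.
    by move: ax; clear; lra.
  + rewrite (_ : H' x = 0) ?scaler0// /H'.
    rewrite derive1E (near_eq_derive (g := cst 0)) ?derive_cst//.
    near=> y; rewrite H0// ltW//; near: y; apply: lt_nbhsl.
    by rewrite subr_lt0.
  + rewrite (_ : H' x = 0) ?scaler0// /H'.
    rewrite derive1E (near_eq_derive (g := cst (1 : R))) ?derive_cst//.
    near=> y; rewrite H1// ltW//; near: y; apply: lt_nbhsr.
    by move: ax; clear; lra.
Unshelve. all: by end_near. Qed.

End cutoff.

(** * Smooth approximation of half-open intervals *)

Section cell_bump.
Context {R : realType}.

(* The factor k e^k beats the value e^-k of the flat function at distance 1/k,
   so that the limit is 1 at the left end point a too. *)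
Definition cell_bump (a b : R) k (x : R) : R :=
  1 - expR (- (k.+1%:R * expR k.+1%:R) * flat_bump (a - k.+1%:R^-1) b x).

Lemma smooth1_cell_bump a b k : smooth1 (cell_bump a b k).
Proof.
move=> l; rewrite (_ : cell_bump a b k = cst 1 \+ (cst (-1) \*
    (expR \o (cst (- (k.+1%:R * expR k.+1%:R)) \* flat_bump (a - k.+1%:R^-1) b)))).
  apply: derivable_uptoD; first exact: derivable_upto_cst.
  apply: derivable_uptoM; first exact: derivable_upto_cst.
  apply: derivable_upto_expR; apply: derivable_uptoM; first exact: derivable_upto_cst.
  exact: smooth1_flat_bump.
by apply/funext => x /=; rewrite mulN1r.
Qed.

Lemma cell_bump01 a b k x : 0 <= cell_bump a b k x <= 1.
Proof.
rewrite /cell_bump subr_ge0 expR_le1 gerBl expR_ge0 andbT mulNr oppr_le0.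
by rewrite !mulr_ge0 ?expR_ge0 ?flat_exp0_ge0.
Qed.

Lemma cell_bump_eq0l a b k x : x <= a - k.+1%:R^-1 -> cell_bump a b k x = 0.
Proof. by move=> xa; rewrite /cell_bump flat_bump_eq0l// mulr0 expR0 subrr. Qed.

Lemma cell_bump_eq0r a b k x : b <= x -> cell_bump a b k x = 0.
Proof. by move=> xa; rewrite /cell_bump flat_bump_eq0r// mulr0 expR0 subrr. Qed.

(** The supports extend slightly to the left of a but stop exactly at b, so the limit is the
    indicator function of the half-open interval at every point, which fits the dyadic cells. *)
Lemma cvg_cell_bump a b x :
  cell_bump a b k x @[k --> \oo] --> (\1_(`[a, b[%classic : set R) x : R).
Proof.
rewrite indicE; have [xab|xab] := boolP (x \in `[a, b[).
  rewrite mem_set//=; move: xab; rewrite in_itv/= => /andP[ax xb].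
  pose w := flat_exp 0 (b - x); have w0 : 0 < w by rewrite flat_exp0_gt0// subr_gt0.
  apply: (@squeeze_cvgr _ _ _ _ (fun k => 1 - w^-1 * k.+1%:R^-1) (cst 1)).
  (* Here exp(-t) <= 1/t for the exponent t, and t >= w (k+1): by monotonicity the left factor of
     the bump is at least its value e^-(k+1) at distance 1/(k+1) from the left end of the
     support. *)
  - near=> k; have /andP[_ ->] := cell_bump01 a b k x; rewrite andbT.
    rewrite lerD2l lerN2 -invfM -[leLHS]invrK.
    rewrite lef_pV2 ?posrE ?invr_gt0 ?expR_gt0 ?mulr_gt0//.
    rewrite -expRN mulNr opprK.
    apply: (@le_trans _ _ (1 + w * k.+1%:R)); first by rewrite lerDr.
    apply: le_trans (expR_ge1Dx _); rewrite lerD2l mulrC -mulrA ler_pM2l//.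
    rewrite /flat_bump -/w mulrA ler_peMl ?(ltW w0)//.
    rewrite -[leLHS](expRxMexpNx_1 k.+1%:R) ler_pM2l ?expR_gt0//.
    apply: (@le_trans _ _ (flat_exp 0 (k.+1%:R^-1))).
      by rewrite /flat_exp invr_gt0 ltr0n/= invrK mul1r.
    by apply: flat_exp0_ndecr; rewrite opprB addrCA lerDl subr_ge0.
  - rewrite -[X in _ --> X](subr0 (1 : R)) -[X in _ --> _ - X](mulr0 w^-1).
    apply: cvgB; first exact: cvg_cst.
    apply: cvgM; [exact: cvg_cst|exact: cvg_harmonic].
  - exact: cvg_cst.
rewrite memNset/=; last exact/negP.
move: xab; rewrite in_itv/= negb_and -ltNge -leNgt => /orP[xa|bx]; last first.
  rewrite (_ : (fun _ => _) = cst 0); first exact: cvg_cst.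
  by apply/funext => k; rewrite cell_bump_eq0r.
apply: (@cvg_trans _ (cst 0 @ \oo)); last exact: cvg_cst.
apply: near_eq_cvg; near=> k.
rewrite /= cell_bump_eq0l// lerBrDr -lerBrDl.
near: k; have := @cvg_harmonic R; move/cvgr_le; apply.
by rewrite subr_gt0.
Unshelve. all: by end_near. Qed.

End cell_bump.

(** * Product test functions *)

Section product_functions.
Context {R : realType} {n : nat}.
Implicit Types (phi : 'I_n.+1 -> R -> R) (z : 'rV[R]_n.+1).

Definition prod_fun phi z : R := \prod_i phi i (z ord0 i).

Lemma differentiable_prod_fun phi z : (forall i, smooth1 (phi i)) ->
  differentiable (prod_fun phi) z.
Proof.
move=> sphi; rewrite /prod_fun.
elim: (index_enum _) => [|i r ih].
  rewrite (_ : (fun _ => _) = cst 1); first exact: differentiable_cst.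
  by apply/funext => u; rewrite big_nil.
rewrite (_ : (fun _ => _) = (fun z => phi i (z ord0 i)) *
    (fun z => \prod_(j <- r) phi j (z ord0 j))); last first.
  by apply/funext => u; rewrite big_cons.
apply: differentiableM => //.
apply: (@differentiable_comp _ _ _ _ (fun z => z ord0 i) (phi i)).
  exact: differentiable_coord.
by apply/derivable1_diffP; exact: smooth1_derivable.
Qed.

Lemma partial_prod_fun phi j : (forall i, smooth1 (phi i)) ->
  partial j (prod_fun phi) =
  prod_fun (fun i => if i == j then derive1 (phi i) else phi i).
Proof.
move=> sphi; apply/funext => z; rewrite /partial /prod_fun.
pose C := \prod_(i | i != j) phi i (z ord0 i).
rewrite [RHS](bigD1 j)//= eqxx.
rewrite (eq_bigr (fun i => phi i (z ord0 i))); last by move=> i /negbTE ->.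
rewrite -/C mulrC derive1E -[RHS]/(C *: _) -deriveZ; last exact: smooth1_derivable.
rewrite /derive; congr (lim (_ @ 0^')); apply/funext => h /=; congr (_ *: _).
have E x : \prod_i phi i ((x *: delta_mx ord0 j + z) ord0 i) = C * phi j (x + z ord0 j).
  rewrite (bigD1 j)//= mulrC !mxE !eqxx mulr1; congr (_ * _).
  by apply: eq_bigr => i /negbTE ij; rewrite !mxE eqxx ij mulr0 add0r.
rewrite E [h *: 1]mulr1; congr (_ - _).
by have := E 0; rewrite scale0r !add0r.
Qed.

(** A partial derivative of a product function is again a product of smooth functions, so
    differentiability at all orders reduces to that of product functions. *)
Lemma smooth_prod_fun phi : (forall i, smooth1 (phi i)) -> smooth (prod_fun phi).
Proof.
move=> sphi s z.
suff [psi spsi E] : exists2 psi, forall i, smooth1 (psi i) &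
    foldr partial (prod_fun phi) s = prod_fun psi.
  by have := differentiable_prod_fun z spsi; rewrite -E.
elim: s => [|j s [psi spsi E]] /=; first by exists phi.
exists (fun i => if i == j then derive1 (psi i) else psi i).
  by move=> i; case: ifP => // _; exact: smooth1_derive1.
by rewrite E partial_prod_fun.
Qed.

Lemma test_function_prod_fun phi (a b : 'I_n.+1 -> R) :
  (forall i, smooth1 (phi i)) ->
  (forall i x, x \notin `[a i, b i] -> phi i x = 0) -> test_function (prod_fun phi).
Proof.
move=> sphi phi0; split; first exact: smooth_prod_fun.
pose B : set 'rV[R]_n.+1 := [set v | forall i, `[a i, b i]%classic (v ord0 i)].
have cB : compact B.
  by apply: (@rV_compact _ _ (fun i => `[a i, b i]%classic)) => i; exact: segment_compact.
apply: (subclosed_compact _ cB); first exact: closed_closure.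
rewrite (closure_id B).1; last exact: compact_closed.
apply: closure_subset => z /= /eqP; apply: contra_notP => /existsNP[i zi].
rewrite /prod_fun (bigD1 i)//= phi0 ?mul0r//; exact/negP.
Qed.

Lemma iter_partial_prod_fun phi j k : (forall i, smooth1 (phi i)) ->
  iter k (partial j) (prod_fun phi) =
  prod_fun (fun i => if i == j then iter k (@derive1 R R) (phi i) else phi i).
Proof.
move=> sphi; elim: k => [|k ih] /=.
  by congr (prod_fun _); apply/funext => i; case: ifP.
rewrite ih partial_prod_fun.
  by congr (prod_fun _); apply/funext => i; case: (i == j).
by move=> i; case: ifP => // _; exact: smooth1_iter_derive1.
Qed.

Lemma multi_partial_prod_fun phi (al : 'I_n.+1 -> nat) : (forall i, smooth1 (phi i)) ->
  multi_partial al (prod_fun phi) =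
  prod_fun (fun i => iter (al i) (@derive1 R R) (phi i)).
Proof.
move=> sphi; rewrite /multi_partial.
have E s : uniq s ->
    foldr (fun i psi => iter (al i) (partial i) psi) (prod_fun phi) s =
    prod_fun (fun i => if i \in s then iter (al i) (@derive1 R R) (phi i) else phi i).
  elim: s => [|j s ih] //= /andP[js us]; rewrite ih// iter_partial_prod_fun.
    congr (prod_fun _); apply/funext => i; rewrite inE.
    by case: eqVneq => [->|//] /=; rewrite (negbTE js).
  by move=> i; case: ifP => // _; exact: smooth1_iter_derive1.
rewrite E ?enum_uniq//; congr (prod_fun _); apply/funext => i.
by rewrite mem_enum.
Qed.

End product_functions.

(** * Integrals against product test functions *)

Section pairing.
Context {R : realType} {n : nat}.
Local Notation mu := (@lebesgue_rV R n.+1).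
Implicit Types (g h : 'rV[R]_n.+1 -> R) (theta : 'I_n.+1 -> R -> R).

Lemma measurable_prod_fun theta : (forall i, smooth1 (theta i)) ->
  measurable_fun setT (prod_fun theta).
Proof.
move=> st; apply: measurable_prod => i _.
apply: (measurableT_comp (f := theta i)); last exact: measurable_coor.
by apply: continuous_measurable_fun; exact: smooth1_continuous.
Qed.

Lemma prod_fun_le theta (B : R) z : (forall i x, `|theta i x| <= B) ->
  `|prod_fun theta z| <= B ^+ n.+1.
Proof.
move=> tB; rewrite /prod_fun normr_prod -[in leRHS](card_ord n.+1) -prodr_const.
by apply: ler_prod => i _; rewrite normr_ge0/= tB.
Qed.

Lemma prod_fun_eq0 theta (a b : 'I_n.+1 -> R) z :
  (forall i x, x \notin `[a i, b i] -> theta i x = 0) ->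
  ~ rV_box (fun i => `[a i, b i]%classic) z -> prod_fun theta z = 0.
Proof.
move=> t0 /existsNP[i zi]; rewrite /prod_fun (bigD1 i)//= t0 ?mul0r//.
exact/negP.
Qed.

Lemma compact_rV_box (a b : 'I_n.+1 -> R) :
  compact (rV_box (fun i => `[a i, b i]%classic)).
Proof.
by apply: (@rV_compact _ _ (fun i => `[a i, b i]%classic)) => i; exact: segment_compact.
Qed.

Lemma integrable_locally_L1 g (a b : 'I_n.+1 -> R) : locally_L1 g ->
  mu.-integrable (rV_box (fun i => `[a i, b i]%classic)) (EFin \o g).
Proof.
move=> [mg gK]; apply/integrableP; split.
  by apply/measurable_EFinP; exact: measurable_funTS.
exact: (gK _ (@compact_rV_box a b)).
Qed.

Lemma integrable_pairing g theta (a b : 'I_n.+1 -> R) (B : R) : locally_L1 g ->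
  (forall i, smooth1 (theta i)) -> (forall i x, `|theta i x| <= B) ->
  (forall i x, x \notin `[a i, b i] -> theta i x = 0) ->
  mu.-integrable setT (fun z => (g z * prod_fun theta z)%:E).
Proof.
move=> lg st tB t0.
pose K := rV_box (fun i => `[a i, b i]%classic).
have mK : measurable K by exact: measurable_rV_box.
have iK : mu.-integrable setT (fun z => (B ^+ n.+1)%:E * ((EFin \o g) \_ K) z)%E.
  apply: integrableZl => //; apply/(integrable_mkcond _ mK).
  exact: integrable_locally_L1.
apply: le_integrable iK => //.
  apply/measurable_EFinP; apply: measurable_funM; first by have [] := lg.
  exact: measurable_prod_fun.
move=> z _; rewrite /patch; case: ifPn => zK.
  rewrite /= lee_fin !normrM [leRHS]mulrC ler_wpM2l//.
  by rewrite (le_trans (prod_fun_le z tB))// ler_norm.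
rewrite (prod_fun_eq0 t0); first by rewrite mulr0 mule0.
by move=> Kz; move: zK; rewrite mem_set.
Qed.

(** Hoelder's inequality with exponents 2 and 2. The window has volume V = 2^(n+1), so the L^2 norm
    of the product is at most B^(n+1) V^(1/2), and V^(1/2) <= V. In the application B is
    proportional to the side of the cell, so B^(n+1) is proportional to its volume. *)
Lemma pairing_le h theta (a b : 'I_n.+1 -> R) (S B : R) :
  measurable_fun setT h -> ('N[mu]_2%:E [EFin \o h] <= S%:E)%E -> 0 <= B ->
  (forall i, b i = a i + 2) ->
  (forall i, smooth1 (theta i)) -> (forall i x, `|theta i x| <= B) ->
  (forall i x, x \notin `[a i, b i] -> theta i x = 0) ->
  `|\int[mu]_z (h z * prod_fun theta z)| <= S * (B ^+ n.+1 * 2 ^+ n.+1).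
Proof.
move=> mh hS B0 ab st tB t0.
pose K := rV_box (fun i => `[a i, b i]%classic).
have mK : measurable K by exact: measurable_rV_box.
have muK : mu K = (2 ^+ n.+1)%:E.
  rewrite lebesgue_rV_box//.
  under eq_bigr => i _.
    rewrite lebesgue_measure_itv/= lte_fin ab ltrDl ltr0n/=.
    rewrite -EFinD addrAC subrr add0r.
    over.
  by rewrite prodEFin prodr_const card_ord.
have mt := measurable_prod_fun st.
have t2 : ('N[mu]_2%:E [EFin \o prod_fun theta] <= (B ^+ n.+1 * 2 ^+ n.+1)%:E)%E.
  have c0 : 0 <= B ^+ n.+1 * 2 ^+ n.+1 by rewrite mulr_ge0 ?exprn_ge0.
  rewrite unlock /=.
  apply: (@le_trans _ _ (((B ^+ n.+1 * 2 ^+ n.+1) ^+ 2)%:E `^ 2^-1)%E); last first.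
    by rewrite poweR_EFin -powR_mulrn// -powRrM mulfV// powRr1.
  apply: gt0_ler_poweR => //; rewrite ?in_itv/= ?leey ?andbT.
  - by apply: integral_ge0 => z _; rewrite lee_fin powR_ge0.
  - by rewrite lee_fin exprn_ge0.
  apply: (@le_trans _ _ (\int[mu]_z ((B ^+ n.+1) ^+ 2 * \1_K z)%:E)%E).
    apply: ge0_le_integral => //.
    - apply/measurable_EFinP.
      apply: (measurableT_comp (f := fun x => x `^ 2)); first exact: measurable_powR.
      exact: measurableT_comp.
    - apply/measurable_EFinP; apply: measurable_funM; first exact: measurable_cst.
      exact: measurable_indic.
    - move=> z _; rewrite lee_fin powR_mulrn ?normr_ge0// indicE.
      have [zK|zK] := boolP (z \in K); last first.
        rewrite (prod_fun_eq0 t0) ?normr0 ?expr0n/= ?mulr0//.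
        by move=> Kz; move: zK; rewrite mem_set.
      by rewrite mulr1 lerXn2r ?nnegrE ?exprn_ge0// prod_fun_le.
  have -> : (\int[mu]_z ((B ^+ n.+1) ^+ 2 * \1_K z)%:E =
      ((B ^+ n.+1) ^+ 2)%:E * (2 ^+ n.+1)%:E)%E.
    under eq_integral do rewrite EFinM.
    rewrite ge0_integralZl//; first by rewrite -muK integral_indic// setIT.
    - apply/measurable_EFinP; exact: measurable_indic.
    - by rewrite lee_fin exprn_ge0// exprn_ge0.
  rewrite -EFinM lee_fin exprMn ler_wpM2l ?exprn_ge0//.
  by rewrite expr2 ler_peMl ?exprn_ge0// exprn_ege1// ler1n.
have := @hoelder _ _ _ mu h (prod_fun theta) 2 2 mh mt.
rewrite Lnorm1 => /(_ _ _ _)H.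
have {H} : (\int[mu]_z `|(h z * prod_fun theta z)%:E| <=
    (S * (B ^+ n.+1 * 2 ^+ n.+1))%:E)%E.
  apply: le_trans (H _ _ _) _ => //; first by lra.
  by rewrite EFinM; apply: lee_pmul => //; exact: Lnorm_ge0.
move=> H; rewrite -lee_fin; apply: (le_trans _ H).
have ih : mu.-integrable setT (fun z => (h z * prod_fun theta z)%:E).
  apply/integrableP; split; last exact: le_lt_trans H (ltry _).
  by apply/measurable_EFinP; exact: measurable_funM.
rewrite EFin_normr_Rintegral//; apply: le_abse_integral => //.
by have /measurable_int := ih.
Qed.

End pairing.

Lemma iter_derive1_eq0 {R : realType} (f : R -> R) (a b : R) k :
  (forall x, x \notin `[a, b] -> f x = 0) ->
  forall x, x \notin `[a, b] -> iter k (@derive1 R R) f x = 0.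
Proof.
move=> f0; elim: k => //= k ih x.
rewrite in_itv/= negb_and -!ltNge => /orP[xa|bx];
  rewrite derive1E (near_eq_derive (g := cst (0 : R))) ?derive_cst//.
- near=> y; rewrite ih// in_itv/= negb_and -!ltNge.
  by apply/orP; left; near: y; exact: lt_nbhsl.
- near=> y; rewrite ih// in_itv/= negb_and -!ltNge.
  by apply/orP; right; near: y; exact: lt_nbhsr.
Unshelve. all: by end_near. Qed.

(** * The sup bound *)

Section gradient_pairing.
Context {R : realType} {n : nat}.
Local Notation mu := (@lebesgue_rV R n.+1).
Implicit Types (g h : 'rV[R]_n.+1 -> R) (theta : 'I_n.+1 -> R -> R).

Lemma weakD_le_sobolev m (al : 'I_n.+1 -> nat) g :
  (forall i, (al i <= 2 * m)%N) -> (parabolic_order al <= 2 * m)%N ->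
  ('N[mu]_2%:E [EFin \o weakD al g] <= parabolic_sobolev_norm m g)%E.
Proof.
move=> al2m alm.
pose al' : {ffun 'I_n.+1 -> 'I_(2 * m).+1} := [ffun i => inord (al i)].
have al'E : (fun i => al' i : nat) = al.
  by apply/funext => i; rewrite ffunE inordK// ltnS al2m.
rewrite /parabolic_sobolev_norm (bigD1 (inord (parabolic_order al)))//=.
rewrite (bigD1 al')/=; last by rewrite al'E inordK// ltnS.
rewrite al'E -addeA leeDl// adde_ge0//; last first.
  by apply: sume_ge0 => i _; apply: sume_ge0 => ? _; exact: Lnorm_ge0.
by apply: sume_ge0 => i _; exact: Lnorm_ge0.
Qed.

Lemma le_max_norm (N : ('rV[R]_n.+1 -> R) -> \bar R) (f : 'I_n.+1 -> 'rV[R]_n.+1 -> R) i :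
  (N (f i) <= max_norm N f)%E.
Proof. exact: le_bigmax. Qed.

Lemma max_norm_ge0 (N : ('rV[R]_n.+1 -> R) -> \bar R) (f : 'I_n.+1 -> 'rV[R]_n.+1 -> R) :
  (0 <= max_norm N f)%E.
Proof. exact: bigmax_ge_id. Qed.

Lemma parabolic_sobolev_weakD m (al : 'I_n.+1 -> nat) g :
  parabolic_sobolev m g -> (parabolic_order al <= 2 * m)%N ->
  weak_partial al g (weakD al g).
Proof.
by move=> [_ H] /H[h gh _]; rewrite /weakD; case: xgetP => [k _ //|/(_ h)].
Qed.

(* A mixed derivative d^al with al <> 0 is split as d^(al - e_i) d_i, with i the
   time direction whenever it occurs in al: the remaining derivative then has
   parabolic order at most n. *)
Lemma gradient_class_pairing m g f (S : R) (al : 'I_n.+1 -> bool) theta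
    (a b : 'I_n.+1 -> R) :
  (0 < n <= 2 * m)%N -> gradient_class m g f ->
  (max_norm (parabolic_sobolev_norm m) f <= S%:E)%E ->
  (forall i, smooth1 (theta i)) ->
  (forall i x, x \notin `[a i, b i] -> theta i x = 0) ->
  exists h, [/\ measurable_fun setT h, ('N[mu]_2%:E [EFin \o h] <= (1 + S)%:E)%E &
    `|\int[mu]_z (g z * prod_fun (fun i => iter (al i) (@derive1 R R) (theta i)) z)| =
    `|\int[mu]_z (h z * prod_fun theta z)|].
Proof.
move=> /andP[n0 nm] [_ g1 gf fm] fS st t0.
have S0 : 0 <= S.
  by rewrite -lee_fin; apply: le_trans fS; exact: max_norm_ge0.
have [[i ali alT]|al0] :
    (exists2 i, al i & al ord_max -> i = ord_max) \/ (forall i, ~~ al i).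
- have [alT|alT] := boolP (al ord_max); first by left; exists ord_max.
  have [/existsP[i ali]|/existsPn] := boolP [exists i, al i]; last by right.
  by left; exists i => // alT'; rewrite alT' in alT.
- pose al' j : nat := al j && (j != i).
  have ord_al' : (parabolic_order al' <= n)%N.
    rewrite /parabolic_order; apply: (@leq_trans (\sum_(j < n.+1) (j != ord_max))%N).
      apply: leq_sum => j _; rewrite /anisotropy /al'.
      have [->|jm] := eqVneq j ord_max; last by rewrite mul1n leq_b1.
      have [alT'|] := boolP (al ord_max); last by rewrite muln0.
      by rewrite (alT alT') eqxx.
    rewrite big_ord_recr/= eqxx addn0.
    apply: (@leq_trans (\sum_(j < n) 1)%N); first by apply: leq_sum => j _; exact: leq_b1.
    by rewrite sum1_card card_ord.
  have [Lg Lf gf_] := gf i.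
  have [_ Lh fh_] := parabolic_sobolev_weakD (fm i) (leq_trans ord_al' nm).
  set h := weakD al' (f i) in Lh fh_.
  exists h; split; first by have [] := Lh.
    apply: (@le_trans _ _ S%:E); last by rewrite lee_fin lerDr.
    apply: le_trans fS; apply: le_trans (le_max_norm _ _ i).
    apply: weakD_le_sobolev; last exact: leq_trans ord_al' nm.
    move=> j; apply: leq_trans (leq_b1 _) _.
    exact: leq_trans n0 nm.
  (* Two integrations by parts: [gf_] turns the pairing of g with d^al Theta into that of f_i with
     d^al' Theta, and [fh_] turns the latter into the pairing of h with Theta. The signs disappear
     in the absolute values. *)
  pose theta' j := iter (al' j) (@derive1 R R) (theta j).
  have st' j : smooth1 (theta' j) by exact: smooth1_iter_derive1.
  have := fh_ _ (test_function_prod_fun st t0).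
  rewrite multi_partial_prod_fun// -/theta' => E.
  have tt' : test_function (prod_fun theta').
    apply: (@test_function_prod_fun _ _ _ a b st') => j x xj.
    by apply: iter_derive1_eq0 xj; exact: t0.
  have := gf_ _ tt'; rewrite multi_partial_prod_fun//.
  rewrite (_ : (fun j => iter (j == i) _ _) =
               fun j => iter (al j) (@derive1 R R) (theta j)).
    move=> ->; rewrite normrM normrX normrN1 expr1n mul1r.
    by rewrite E normrM normrX normrN1 expr1n mul1r.
  apply/funext => j; rewrite /theta' /al'.
  by have [->|ji] := eqVneq j i; rewrite ?ali ?andbT //= andbF.
- exists g; split; first by case: (gf ord0) => -[].
    by apply: le_trans g1 _; rewrite lee_fin lerDl.
  by under [X in prod_fun X]eq_fun do rewrite (negbTE (al0 _)).
Qed.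

End gradient_pairing.

Section sobolev.
Context {R : realType} {n : nat}.
Local Notation mu := (@lebesgue_rV R n.+1).

Lemma Rintegral_sum d (T : measurableType d) (nu : {measure set T -> \bar R})
    (I : Type) (s : seq I) (h : I -> T -> R) :
  (forall i, nu.-integrable setT (EFin \o h i)) ->
  \int[nu]_x (\sum_(i <- s) h i x) = \sum_(i <- s) \int[nu]_x h i x.
Proof.
move=> ih; elim: s => [|i s IH].
  under eq_Rintegral do rewrite big_nil.
  by rewrite big_nil Rintegral_cst// mul0r.
under eq_Rintegral do rewrite big_cons.
rewrite big_cons -IH RintegralD//.
rewrite (_ : EFin \o _ = fun x => (\sum_(i <- s) (h i x)%:E)%E).
  by apply: integrable_sum => // j _; exact: ih.
by apply/funext => x /=; rewrite sumEFin.
Qed.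

Lemma prod_fun_sum (theta : 'I_n.+1 -> bool -> R -> R) z :
  prod_fun (fun i x => theta i true x + theta i false x) z =
  \sum_(al : {ffun 'I_n.+1 -> bool}) prod_fun (fun i => theta i (al i)) z.
Proof.
rewrite /prod_fun -(bigA_distr_bigA (fun i b => theta i b (z ord0 i))).
by apply: eq_bigr => i _; rewrite big_bool.
Qed.

(* Expanding the product of the one-dimensional decompositions of the cell
   functions gives sum over al in {0,1}^(n+1) of d^al of test functions. *)
Lemma prod_cell_bump_pairing_le : exists2 M : R, 0 <= M &
  forall m g f (S : R) (a : 'I_n.+1 -> R) (w : R) k,
  (0 < n <= 2 * m)%N -> gradient_class m g f ->
  (max_norm (parabolic_sobolev_norm m) f <= S%:E)%E -> 0 < w <= 1 ->
  `|\int[mu]_z (g z * prod_fun (fun i => cell_bump (a i) (a i + w) k) z)| <=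
  M * (1 + S) * (w + k.+1%:R^-1) ^+ n.+1.
Proof.
have [K K0 HK] := @bump_decomposition R.
(* One factor counts the terms of the expansion; the other comes from the height and the window of
   each of them. *)
exists (#|{ffun 'I_n.+1 -> bool}|%:R * (K ^+ n.+1 * 2 ^+ n.+1)).
  by rewrite !mulr_ge0 ?exprn_ge0.
move=> m g f S a w k nm gfm fS /andP[w0 w1].
have k0 : 0 < k.+1%:R^-1 :> R by rewrite invr_gt0.
have k1 : k.+1%:R^-1 <= 1 :> R by rewrite invf_le1// ler1n.
(* Left end of the support of the i-th bump; the support has length w + 1/(k+1) <= 2 and fits in the
   window. *)
pose A i := a i - k.+1%:R^-1.
pose B := K * (w + k.+1%:R^-1).
have B0 : 0 <= B by rewrite mulr_ge0// addr_ge0 ?ltW.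
have Aw i : A i <= a i + w <= A i + 2.
  by rewrite /A; move: k0 k1 w0 w1; move: (_^-1) => r; clear; lra.
have /choice[theta th] i := HK (A i) (a i + w) (cell_bump (a i) (a i + w) k)
  (Aw i) (@smooth1_cell_bump _ _ _ _)
  (cell_bump01 _ _ _) (@cell_bump_eq0l _ _ _ _) (@cell_bump_eq0r _ _ _ _).
have st i b : smooth1 (theta i b) by have [] := th i.
have tB i b x : `|theta i b x| <= B.
  have [_ _ /(_ b x) + _] := th i; rewrite /B /A.
  by rewrite opprB addrC addrA subrK addrC.
have t0 i b x : x \notin `[A i, A i + 2] -> theta i b x = 0.
  by have [_ _ _] := th i; exact.
pose term (al : {ffun 'I_n.+1 -> bool}) :=
  prod_fun (fun i => iter (al i) (@derive1 R R) (theta i (al i))).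
rewrite (_ : prod_fun _ = fun z => \sum_al term al z); last first.
  apply/funext => z.
  rewrite -(prod_fun_sum (fun i b => iter b (@derive1 R R) (theta i b))).
  by congr (prod_fun _ z); apply/funext => i; apply/funext => x; have [_ ->] := th i.
rewrite [X in `|X|](_ : _ = \int[mu]_z \sum_al (g z * term al z)); last first.
  by apply: eq_Rintegral => z _; rewrite mulr_sumr.
rewrite Rintegral_sum; last first.
  move=> al.
  (* The derivative of [theta i true] is the bump minus [theta i false], hence at most 1 + B in
     absolute value. This crude bound serves only for integrability. *)
  apply: (@integrable_pairing _ _ g _ A (fun i => A i + 2) (1 + B)).
  - by have [_ _ gf _] := gfm; have [] := gf ord0.
  - by move=> i; exact: smooth1_iter_derive1.
  - move=> i x; case: (al i) => /=; last by rewrite (le_trans (tB _ _ _))// lerDr.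
    have [_ /(_ x) E _ _] := th i; move/eqP: E; rewrite -subr_eq => /eqP <-.
    rewrite (le_trans (ler_normB _ _))// lerD// ger0_norm.
      by have /andP[] := cell_bump01 (a i) (a i + w) k x.
    by have /andP[] := cell_bump01 (a i) (a i + w) k x.
  - by move=> i; apply: iter_derive1_eq0; exact: t0.
apply: le_trans (ler_norm_sum _ _ _) _.
rewrite -!mulrA mulr_natl -[leRHS]sumr_const.
apply: ler_sum => al _.
have [h [mh hS ->]] := gradient_class_pairing al nm gfm fS
  (fun i => st i (al i)) (fun i => t0 i (al i)).
have := pairing_le mh hS B0 (fun i => erefl) (fun i => st i (al i))
   (fun i => tB i (al i)) (fun i => t0 i (al i)).
move=> /le_trans; apply.
rewrite /B exprMn.
by rewrite le_eqVlt; apply/orP; left; apply/eqP; ring.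
Qed.

End sobolev.

Section sup_bound.
Context {R : realType} {n : nat}.
Local Notation mu := (@lebesgue_rV R n.+1).

Lemma cvg_prod_fun (phi : nat -> 'I_n.+1 -> R -> R) (psi : 'I_n.+1 -> R -> R) z :
  (forall i x, phi k i x @[k --> \oo] --> psi i x) ->
  prod_fun (phi k) z @[k --> \oo] --> prod_fun psi z.
Proof.
move=> h; rewrite /prod_fun; elim: (index_enum _) => [|i r ih].
  by rewrite big_nil; under eq_fun do rewrite big_nil; exact: cvg_cst.
by rewrite big_cons; under eq_fun do rewrite big_cons; exact: cvgM.
Qed.

Lemma prod_fun_indic (J : 'I_n.+1 -> set R) z :
  prod_fun (fun i => \1_(J i) : R -> R) z = \1_(rV_box J) z.
Proof.
rewrite /prod_fun [RHS]indicE; have [/set_mem zJ|zJ] := boolP (z \in rV_box J).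
  by apply: big1 => i _; rewrite indicE mem_set//; exact: zJ.
have /existsNP[i zi] : ~ rV_box J z by move=> h; move: zJ; rewrite mem_set.
by rewrite (bigD1 i)//= indicE memNset// mul0r.
Qed.

(** Dominated convergence: the products of bumps lie in [0, 1], converge everywhere to the indicator
    function of the box, and are all supported in one compact box, on which the locally integrable g
    supplies the dominating function. *)
Lemma box_integral_le (g : 'rV[R]_n.+1 -> R) (a : 'I_n.+1 -> R) (w C : R) :
  locally_L1 g -> 0 < w <= 1 ->
  (forall k, `|\int[mu]_z (g z * prod_fun (fun i => cell_bump (a i) (a i + w) k) z)| <=
    C * (w + k.+1%:R^-1) ^+ n.+1) ->
  `|\int[mu]_(z in rV_box (fun i => `[a i, a i + w[%classic)) g z| <= C * w ^+ n.+1.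
Proof.
move=> lg /andP[w0 w1] gC.
set D := rV_box _.
have mD : measurable D by exact: measurable_rV_box.
pose phi k := prod_fun (fun i => cell_bump (a i) (a i + w) k).
have sphi k i : smooth1 (cell_bump (a i) (a i + w) k) by exact: smooth1_cell_bump.
have phi_le1 k z : `|phi k z| <= 1.
  rewrite -[leRHS](expr1n _ n.+1); apply: prod_fun_le => i x.
  by rewrite ger0_norm; have /andP[] := cell_bump01 (a i) (a i + w) k x.
have mg : measurable_fun setT g by have [] := lg.
pose K := rV_box (fun i => `[a i - 1, a i + 1]%classic).
have mK : measurable K by exact: measurable_rV_box.
have phi0 k i x : x \notin `[a i - 1, a i + 1] -> cell_bump (a i) (a i + w) k x = 0.
  rewrite in_itv/= negb_and -!ltNge => /orP[xa|bx].
    apply: cell_bump_eq0l; apply: le_trans (ltW xa) _.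
    by rewrite lerD2l lerN2 invf_le1// ler1n.
  by apply: cell_bump_eq0r; apply: le_trans (ltW bx); rewrite lerD2l.
have iK : mu.-integrable setT ((abse \o (EFin \o g)) \_ K).
  apply/(integrable_mkcond _ mK); apply: integrable_abse.
  exact: integrable_locally_L1.
have [] := @dominated_convergence _ _ _ mu setT measurableT
  (fun k z => (g z * phi k z)%:E) (fun z => (g z * \1_D z)%:E)
  ((abse \o (EFin \o g)) \_ K).
- move=> k; apply/measurable_EFinP; apply: measurable_funM => //.
  exact: measurable_prod_fun.
- by apply/measurable_EFinP; apply: measurable_funM => //; exact: measurable_indic.
- apply: nearW => z _; apply: cvg_EFin; first exact: nearW.
  apply: cvgM; first exact: cvg_cst.
  rewrite -prod_fun_indic; apply: cvg_prod_fun => i x; exact: cvg_cell_bump.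
- exact: iK.
- apply: nearW => z k _; rewrite /patch; case: ifPn => zK.
    by rewrite /= lee_fin normrM ler_piMr// phi_le1.
  rewrite /phi (prod_fun_eq0 (phi0 k)) ?mulr0 ?abse0//.
  by move=> Kz; move: zK; rewrite mem_set.
move=> ig _.
have IE : (\int[mu]_z (g z * \1_D z)%:E = (\int[mu]_(z in D) g z)%:E)%E.
  rewrite -[LHS](fineK (integrable_fin_num measurableT ig)) /Rintegral; congr (fine _)%:E.
  rewrite [RHS]integral_mkcond; apply: eq_integral => z _.
  by rewrite indicE /patch; case: ifPn => _; rewrite /= ?mulr1 ?mulr0.
rewrite IE => /fine_cvg/cvg_norm cI.
have cC : C * (w + k.+1%:R^-1) ^+ n.+1 @[k --> \oo] --> C * w ^+ n.+1.
  apply: cvgM; first exact: cvg_cst.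
  have h : w + k.+1%:R^-1 @[k --> \oo] --> w + 0.
    by apply: cvgD; [exact: cvg_cst|exact: cvg_harmonic].
  rewrite addr0 in h.
  exact: (@continuous_cvg _ _ _ _ _ _ (@GRing.exp R ^~ n.+1) _
    (@exprn_continuous R n.+1 w) h).
by apply: (ler_cvg_to cI cC); apply: nearW => k; exact: gC.
Qed.

(** The estimate on cells controls the absolute value of the integral, so the comparison on cells
    applies to both g and -g. *)
Lemma gradient_class_Linfty_le : exists2 M : R, 0 <= M &
  forall m g f (S : R), (0 < n <= 2 * m)%N -> gradient_class m g f ->
  (max_norm (@parabolic_sobolev_norm R n m) f <= S%:E)%E ->
  (Linfty_norm g <= (M * (1 + S))%:E)%E.
Proof.
have [M M0 HM] := @prod_cell_bump_pairing_le R n.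
exists M => // m g f S nm gfm fS.
have lg : locally_L1 g by have [_ _ gf _] := gfm; have [] := gf ord0.
have S0 : 0 <= S.
  by rewrite -lee_fin; apply: le_trans fS; exact: max_norm_ge0.
have cell_le k a : `|\int[mu]_(z in @dyadic_cell R k n.+1 @^-1` [set a]) g z| <=
    M * (1 + S) * 2 ^- k ^+ n.+1.
  have w01 : 0 < (2 ^- k : R) <= 1.
    by rewrite invr_gt0 exprn_gt0//= invf_le1 ?exprn_gt0// exprn_ege1// ler1n.
  rewrite dyadic_cell_preimage; apply: box_integral_le => // l.
  exact: (HM m g f).
have ig k a : mu.-integrable (@dyadic_cell R k n.+1 @^-1` [set a]) (EFin \o g).
  rewrite dyadic_cell_preimage.
  have := integrable_locally_L1 (fun i => (a i)%:~R / 2 ^+ k)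
    (fun i => (a i)%:~R / 2 ^+ k + 2 ^- k) lg.
  apply: integrableS.
  - exact: measurable_rV_box.
  - exact: measurable_rV_box.
  - move=> z h i; have := h i; rewrite /= !in_itv/= => /andP[-> /ltW ->]//.
have le1 : {ae mu, forall z, g z <= M * (1 + S)}.
  apply: ae_le_dyadic_cells => // k a.
  rewrite lebesgue_rV_dyadic_cell -EFinM.
  rewrite -(fineK (integrable_fin_num (measurable_dyadic_cell _ _) (ig k a))) lee_fin.
  exact: le_trans (ler_norm _) (cell_le k a).
have le2 : {ae mu, forall z, - g z <= M * (1 + S)}.
  apply: ae_le_dyadic_cells => k a.
    by have := integrableN (ig k a).
  rewrite lebesgue_rV_dyadic_cell -EFinM.
  under eq_integral do rewrite EFinN.
  rewrite integralN/=; last first.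
    exact: (integrable_add_def (measurable_dyadic_cell _ _) (ig k a)).
  rewrite -(fineK (integrable_fin_num (measurable_dyadic_cell _ _) (ig k a))).
  rewrite -EFinN lee_fin.
  by apply: le_trans (cell_le k a); rewrite -normrN; exact: ler_norm.
rewrite /Linfty_norm unlock.
(* The norm of exponent +oo is defined by cases: an essential supremum if the whole space has
   positive measure, and 0 otherwise. *)
case: ifPn => _; last by rewrite lee_fin mulr_ge0// addr_ge0.
apply/ess_supP; apply: filterS2 le1 le2 => z.
by rewrite /= lee_fin ler_norml lerNl => -> ->.
Qed.

End sup_bound.

(** * Estimates on positive parts of logarithms *)

Section logarithms.
Context {R : realType}.

(** The last inequality comes from 1 + S <= 2 max(1, S). *)
Lemma logp_fin (S : R) : 0 <= S ->
  exists l : R, [/\ logp S%:E = l%:E, 0 <= l & ln (1 + S) <= ln 2 + l].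
Proof.
move=> S0; have S1 : 0 < 1 + S by rewrite ltr_pwDl.
have [S_le1|S_gt1] := leP S 1.
  exists 0; split=> //.
    by rewrite /logp; apply/max_idPr; rewrite lne_le0 lee_fin.
  by rewrite addr0 ler_ln ?posrE//; lra.
have S_gt0 : 0 < S by exact: lt_trans S_gt1.
have lnS : 0 <= ln S by rewrite ln_ge0// ltW.
exists (ln S); split=> //.
  by rewrite /logp lne_EFin//; apply/max_idPl; rewrite lee_fin.
rewrite -lnM ?posrE// ler_ln ?posrE ?mulr_gt0//; lra.
Qed.

Lemma logp_ge0 (x : \bar R) : (0 <= logp x)%E.
Proof. by rewrite /logp le_max lexx orbT. Qed.

Lemma le_logp (x y : \bar R) : (0 <= x)%E -> (x <= y)%E -> (logp x <= logp y)%E.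
Proof.
move=> x0 xy; rewrite /logp ge_max !le_max lexx orbT andbT; apply/orP; left.
by rewrite lee_lne// in_itv/= leey andbT// (le_trans x0).
Qed.

(** From S + M (1 + S) <= (1 + M) (1 + S), the logarithm is at most c + log^+ S with c = ln (1 + M)
    + ln 2. Then sqrt x <= 1 + x, and 1 + c + l <= (1 + c) (1 + l) gives C = 1 + c. The bound on L
    is assumed only for real majorants of s: when s is infinite, so is the right-hand side. *)
Lemma sqrt_logp_le (M : R) : 0 <= M -> exists2 C : R, 0 < C &
  forall (s L : \bar R), (0 <= s)%E -> (0 <= L)%E ->
    (forall S : R, (s <= S%:E)%E -> (L <= (M * (1 + S))%:E)%E) ->
    (logp (s + L) `^ 2^-1 <= C%:E * (1 + logp s))%E.
Proof.
move=> M0; have M1 : 0 < 1 + M by rewrite ltr_pwDl.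
have c0 : 0 <= ln (1 + M) by rewrite ln_ge0// lerDl.
have ln2 : 0 <= ln (2 : R) by rewrite ln_ge0// ler1n.
exists (1 + (ln (1 + M) + ln 2)); first by rewrite ltr_pwDl// addr_ge0.
move=> [S| |] L s0 L0 LM //; last first.
  rewrite /logp /= maxye// addey// gt0_muley ?leey// lte_fin.
  by rewrite ltr_pwDl// addr_ge0.
have {}LM := LM _ (lexx _); rewrite lee_fin in s0.
have S1 : 0 < 1 + S by rewrite ltr_pwDl.
have [l [-> l0 lS]] := logp_fin s0.
have MS0 : 0 <= (1 + M) * (1 + S) by rewrite mulr_ge0// ltW.
have le1 : (logp (S%:E + L) <= (ln (1 + M) + ln 2 + l)%:E)%E.
  apply: (@le_trans _ _ (logp ((1 + M) * (1 + S))%:E)).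
    apply: le_logp; first by rewrite adde_ge0// lee_fin.
    apply: (@le_trans _ _ (S%:E + (M * (1 + S))%:E)%E); first by rewrite leeD2l.
    by rewrite -EFinD lee_fin; lra.
  rewrite /logp lne_EFin ?mulr_gt0// lnM ?posrE//.
  rewrite ge_max !lee_fin; apply/andP; split; first by rewrite -addrA lerD2l.
  by rewrite !addr_ge0.
set c := ln (1 + M) + ln 2 in le1 *.
have cl : 0 <= c + l by rewrite !addr_ge0.
apply: (@le_trans _ _ ((c + l)%:E `^ 2^-1)%E).
  apply: gt0_ler_poweR => //; rewrite in_itv/= leey andbT ?logp_ge0//.
rewrite poweR_EFin -EFinD -EFinM lee_fin powR12_sqrt//.
apply: (@le_trans _ _ (1 + (c + l))).
  rewrite -[leRHS]ger0_norm ?addr_ge0// -sqrtr_sqr ler_sqrt ?sqr_ge0//.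
  by rewrite expr2; nra.
have : 0 <= c by rewrite addr_ge0.
by nra.
Qed.

End logarithms.

Theorem theorem1p7 (R : realType) (n m : nat) (n123 : (1 <= n <= 3)%N)
    (m_gt0 : (0 < m)%N) (mn : n.+2%:R / 2 < (2 * m)%:R :> R) :
  (exists2 C : R, 0 < C &
    forall (g : 'rV[R]_n.+1 -> R) (f : 'I_n.+1 -> 'rV[R]_n.+1 -> R),
      gradient_class m g f ->
      (logp (max_norm (parabolic_sobolev_norm m) f + Linfty_norm g) `^ 2^-1
       <= C%:E * (1 + logp (max_norm (parabolic_sobolev_norm m) f)))%E)
  /\
  (forall C1 : R, 0 < C1 -> exists2 C2 : R, 0 < C2 &
    forall (g : 'rV[R]_n.+1 -> R) (f : 'I_n.+1 -> 'rV[R]_n.+1 -> R),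
      gradient_class m g f ->
      (max_norm Linfty_norm f
       <= C1%:E * (1 + max_norm bmo_norm f *
            logp (max_norm (parabolic_sobolev_norm m) f + Linfty_norm g)
              `^ 2^-1))%E ->
      (max_norm Linfty_norm f
       <= C2%:E * (1 + max_norm bmo_norm f *
            (1 + logp (max_norm (parabolic_sobolev_norm m) f))))%E).
Proof.
(* For n <= 2, n <= (n + 2) / 2 < 2m; for n = 3, 2m > 5/2 forces 2m >= 3. *)
have nm : (0 < n <= 2 * m)%N.
  move: mn; rewrite ltr_pdivrMr// -natrM ltr_nat.
  by case/andP: n123 => n1 n3 h; apply/andP; split=> //; lia.
have [M M0 HM] := @gradient_class_Linfty_le R n.
have [C C0 HC] := sqrt_logp_le M0.
have log_le (g : 'rV[R]_n.+1 -> R) f : gradient_class m g f ->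
    (logp (max_norm (parabolic_sobolev_norm m) f + Linfty_norm g) `^ 2^-1
     <= C%:E * (1 + logp (max_norm (parabolic_sobolev_norm m) f)))%E.
  move=> gf; apply: HC; [exact: max_norm_ge0|exact: Lnorm_ge0|].
  by move=> S; exact: (HM _ _ _ _ nm gf).
split; first by exists C.
(* With Z = |f|_BMO (1 + log^+ |f|_W), the first part bounds the bracket by 1 + C Z, which is at
   most (1 + C) (1 + Z); Z may be infinite. *)
move=> C1 C10; exists (C1 * (1 + C)); first by rewrite mulr_gt0// addr_gt0.
move=> g f gf /le_trans; apply.
rewrite EFinM -muleA lee_pmul2l//.
have := log_le _ _ gf.
set y := (_ `^ _)%E; set l := logp _; set B := max_norm bmo_norm f => yl.
have l0 : (0 <= l)%E by exact: logp_ge0.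
have B0 : (0 <= B)%E by exact: max_norm_ge0.
have Z0 : (0 <= B * (1 + l))%E by rewrite mule_ge0// adde_ge0.
apply: (@le_trans _ _ (1 + C%:E * (B * (1 + l))))%E.
  by rewrite leeD2l// muleCA lee_wpmul2l.
move: (B * (1 + l))%E Z0 => [z| |]// z0.
  by rewrite -EFinM -!EFinD -EFinM lee_fin; rewrite lee_fin in z0; nra.
by rewrite [leRHS](_ : _ = +oo%E) ?leey// addey// gt0_muley// lte_fin addr_gt0.
Qed.
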